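(* Let $(M,\omega)$ be a compact, connected symplectic manifold which is quantizable (that is, $[\omega]$ is an integral cohomology class). If $\psi=\{\psi_t\}_{t\in[0,1]}$ is a closed Hamiltonian isotopy of $(M,\omega)$ (so $\psi_0=\psi_1=\mathrm{id}$), then the action integral $\kappa_x(\psi)\in U(1)$ along the curve $\{\psi_t(x)\mid t\in[0,1]\}$ is independent of the point $x\in M$.
   Context: Let $\dim M=2n$. A Hamiltonian isotopy $\{\psi_t\}_{t\in[0,1]}$ with time-dependent Hamiltonian $f_t$ is the isotopy determined by $\frac{d\psi_t(x)}{dt}=X_t(\psi_t(x))$, $\psi_0=\mathrm{id}$, where $\iota_{X_t}\omega=-df_t$; the Hamiltonian is normalized by $\int_M f_t\,\omega^n=0$. If $\psi_1=\mathrm{id}$, then for each $x\in M$ the closed curve $\{\psi_t(x)\}_t$ is nullhomologous (known fact), and one sets $$\kappa_x(\psi):=\exp\Big(2\pi i\int_S\omega-2\pi i\int_0^1 f_t(\psi_t(x))\,dt\Big),$$ where $S$ is any $2$-chain in $M$ whose boundary is this curve. Since $[\omega]$ is integral, this does not depend on the choice of $S$. *)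

(* Defs.v *)
From HB Require Import structures.
From mathcomp Require Import all_boot all_order all_algebra all_fingroup.
From mathcomp Require Import complex.
From mathcomp Require Import all_classical all_reals all_analysis.

Set Implicit Arguments.
Unset Strict Implicit.
Unset Printing Implicit Defensive.

Import Order.TTheory GRing.Theory Num.Theory.
Import numFieldNormedType.Exports.

Local Open Scope classical_set_scope.
Local Open Scope ring_scope.

Definition basis_vec (R : realType) (a : nat) (i : 'I_a) : 'rV[R]_a :=
  delta_mx 0 i.

(* Meant for U open: all partial derivatives of order <= k exist and are
   continuous at the points of U. *)
Fixpoint Ck (R : realType) (a : nat) (W : normedModType R) (k : nat)
    (U : set 'rV[R]_a) (g : 'rV[R]_a -> W) : Prop :=
  (forall x, U x -> {for x, continuous g}) /\
  (if k is k'.+1 then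
     forall i : 'I_a, (forall x, U x -> derivable g x (basis_vec R i)) /\
       Ck k' U (fun x => 'D_(basis_vec R i) g x : W)
   else True).

Definition smooth (R : realType) (a : nat) (W : normedModType R)
    (U : set 'rV[R]_a) (g : 'rV[R]_a -> W) : Prop :=
  forall k, Ck k U g.

(* Smoothness on an arbitrary subset A: local existence of smooth extensions
   to open sets. *)
Definition smooth_on (R : realType) (a : nat) (W : normedModType R)
    (A : set 'rV[R]_a) (g : 'rV[R]_a -> W) : Prop :=
  forall x, A x -> exists (U : set 'rV[R]_a) (h : 'rV[R]_a -> W),
    [/\ open U, U x, smooth U h & forall y, (A `&` U) y -> h y = g y].

(* The atlas need not be maximal. [chart_at] names a chart around each point;
   [coord c] and [param c] are only meaningful on [dom c] and its image. *)
Record manifold (R : realType) (m : nat) := Manifold {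
  space :> topologicalType;
  space_hausdorff : hausdorff_space space;
  space_second_countable : @second_countable space;
  chart : Type;
  dom : chart -> set space;
  coord : chart -> space -> 'rV[R]_m;
  param : chart -> 'rV[R]_m -> space;
  chart_at : space -> chart;
  dom_chart_at : forall x, dom (chart_at x) x;
  open_dom : forall c, open (dom c);
  open_coord : forall c, open (coord c @` dom c);
  coordK : forall c x, dom c x -> param c (coord c x) = x;
  coord_continuous : forall c, {within dom c, continuous (coord c)};
  param_continuous :
    forall c, {within coord c @` dom c, continuous (param c)};
  transition_smooth : forall c d,
    smooth (coord c @` (dom c `&` dom d)) (coord d \o param c)
}.

Arguments dom {R m} M c : rename.
Arguments coord {R m} M c : rename.
Arguments param {R m} M c : rename.
Arguments chart_at {R m} M x : rename.

Definition coord_dom (R : realType) (m : nat) (M : manifold R m)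
    (c : chart M) : set 'rV[R]_m :=
  coord M c @` dom M c.

Definition smooth_map (R : realType) (m : nat) (M : manifold R m) (a : nat)
    (A : set 'rV[R]_a) (s : 'rV[R]_a -> M) : Prop :=
  {within A, continuous s} /\
  forall c : chart M, smooth_on (A `&` s @^-1` dom M c) (coord M c \o s).

(* [omega c x] is the matrix of the values of the form at x on pairs of
   coordinate vector fields of the chart c. *)
Record two_form (R : realType) (m : nat) (M : manifold R m) := TwoForm {
  form :> chart M -> M -> 'M[R]_m;
  form_alternating : forall c x, dom M c x -> (form c x)^T = - form c x;
  form_smooth : forall c, smooth (coord_dom c) (form c \o param M c);
  form_transition : forall c d x, dom M c x -> dom M d x ->
    let J := jacobian (coord M d \o param M c) (coord M c x) in
    form c x = J *m form d x *m J^T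
}.

Definition closed_form (R : realType) (m : nat) (M : manifold R m)
    (omega : two_form M) : Prop :=
  forall (c : chart M) (x : M) (i j k : 'I_m), dom M c x ->
    let w (p q : 'I_m) (u : 'rV[R]_m) : R := omega c (param M c u) p q in
    let D (l : 'I_m) (g : 'rV[R]_m -> R) : R :=
      'D_(basis_vec R l) g (coord M c x) in
    D i (w j k) + D j (w k i) + D k (w i j) = 0.

Definition nondegenerate (R : realType) (m : nat) (M : manifold R m)
    (omega : two_form M) : Prop :=
  forall (c : chart M) (x : M), dom M c x -> omega c x \in unitmx.

Definition symplectic (R : realType) (m : nat) (M : manifold R m)
    (omega : two_form M) : Prop :=
  closed_form omega /\ nondegenerate omega.

(* Barycentric coordinates; vertex i is the i-th basis vector. *)
Definition std_simplex (R : realType) (k : nat) : set 'rV[R]_k.+1 :=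
  [set u | (forall i, 0 <= u 0 i) /\ \sum_i u 0 i = 1].
Arguments std_simplex : clear implicits.

Definition face (R : realType) (k : nat) (i : 'I_k.+2) (u : 'rV[R]_k.+1) :
    'rV[R]_k.+2 :=
  \row_j (if unlift i j is Some l then u 0 l else 0).

(* A singular k-simplex is represented by a total function of which only the
   restriction to the standard simplex matters. *)
Definition simplex (R : realType) (m : nat) (M : manifold R m) (k : nat) :=
  'rV[R]_k.+1 -> M.

Definition smooth_simplex (R : realType) (m : nat) (M : manifold R m)
    (k : nat) (s : simplex M k) : Prop :=
  smooth_map (std_simplex R k) s.

Definition eq_simplex (R : realType) (m : nat) (M : manifold R m) (k : nat)
    (s s' : simplex M k) : Prop :=
  forall u, std_simplex R k u -> s u = s' u.

Definition simplex_face (R : realType) (m : nat) (M : manifold R m) (k : nat)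
    (i : 'I_k.+2) (s : simplex M k.+1) : simplex M k :=
  fun u => s (face i u).

(* Formal integral combinations, considered up to [eq_chain]. *)
Definition chain (R : realType) (m : nat) (M : manifold R m) (k : nat) :=
  seq (int * simplex M k).

Definition smooth_chain (R : realType) (m : nat) (M : manifold R m) (k : nat)
    (S : chain M k) : Prop :=
  all (fun p => `[< smooth_simplex p.2 >]) S.

Definition chain_coef (R : realType) (m : nat) (M : manifold R m) (k : nat)
    (S : chain M k) (s : simplex M k) : int :=
  \sum_(p <- S | `[< eq_simplex p.2 s >]) p.1.

Definition eq_chain (R : realType) (m : nat) (M : manifold R m) (k : nat)
    (S S' : chain M k) : Prop :=
  forall s, chain_coef S s = chain_coef S' s.

Definition boundary (R : realType) (m : nat) (M : manifold R m) (k : nat)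
    (S : chain M k.+1) : chain M k :=
  [seq ((-1) ^+ (i : nat) * p.1, simplex_face i p.2)
     | p : int * simplex M k.+1 <- S, i : 'I_k.+2 <- enum 'I_k.+2].

(* Only the values at smooth simplices are relevant. *)
Definition is_cochain (R : realType) (m : nat) (M : manifold R m) (k : nat)
    (A : Type) (z : simplex M k -> A) : Prop :=
  forall s s', eq_simplex s s' -> z s = z s'.

Definition coboundary (R : realType) (m : nat) (M : manifold R m) (k : nat)
    (A : zmodType) (z : simplex M k -> A) (s : simplex M k.+1) : A :=
  \sum_(i < k.+2) (z (simplex_face i s)) *~ ((-1) ^+ i).

Definition barycentric2 (R : realType) (u v : R) : 'rV[R]_3 :=
  \row_j [:: 1 - u - v; u; v]`_j.

(* The function g with s^*omega = g du /\ dv, at an interior point of the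
   triangle u, v >= 0, u + v <= 1. *)
Definition pullback_density (R : realType) (m : nat) (M : manifold R m)
    (omega : two_form M) (s : simplex M 2) (u v : R) : R :=
  let x := s (barycentric2 u v) in
  let c := chart_at M x in
  let s_ (u' v' : R) : 'rV[R]_m := coord M c (s (barycentric2 u' v')) in
  let su := derive1 (fun u' => s_ u' v) u in
  let sv := derive1 (fun v' => s_ u v') v in
  (su *m omega c x *m sv^T) 0 0.

Definition integral_simplex (R : realType) (m : nat) (M : manifold R m)
    (omega : two_form M) (s : simplex M 2) : R :=
  \int[lebesgue_measure]_(u in `]0, 1[%classic)
    \int[lebesgue_measure]_(v in `]0, 1 - u[%classic)
      pullback_density omega s u v.

Definition integral_chain (R : realType) (m : nat) (M : manifold R m)
    (omega : two_form M) (S : chain M 2) : R :=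
  \sum_(p <- S) (p.1)%:~R * integral_simplex omega p.2.

(* [omega] lies in the image of H^2(M; Z) -> H^2(M; R): the cochain given by
   integration of omega is cohomologous to the image z of an integral
   cocycle. *)
Definition integral_class (R : realType) (m : nat) (M : manifold R m)
    (omega : two_form M) : Prop :=
  exists (z : simplex M 2 -> int) (b : simplex M 1 -> R),
    [/\ is_cochain z, is_cochain b,
        forall s : simplex M 3, smooth_simplex s -> coboundary z s = 0 &
        forall s : simplex M 2, smooth_simplex s ->
          integral_simplex omega s = (z s)%:~R + coboundary b s].

(* The component (omega^n)(e_1, ..., e_2n) for omega with matrix A: the pairs
   (k, ordS k) with k even are (0, 1), (2, 3), ..., (2n-2, 2n-1). *)
Definition top_power (R : realType) (n : nat) (A : 'M[R]_(n.*2)) : R :=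
  2%:R ^- n * \sum_(s : 'S_(n.*2))
    (-1) ^+ s * \prod_(k < n.*2 | ~~ odd k) A (s k) (s (ordS k)).

(* Iterated integral over R^m; used for continuous functions with compact
   support. *)
Fixpoint iterated_integral (R : realType) (m : nat) :
    ('rV[R]_m -> R) -> R :=
  match m with
  | 0 => fun g => g 0
  | m'.+1 => fun g => \int[lebesgue_measure]_(x in [set: R])
      iterated_integral (fun v : 'rV[R]_m' => g (row_mx (const_mx x : 'rV_1) v))
  end.

Definition smooth_function (R : realType) (m : nat) (M : manifold R m)
    (g : M -> R) : Prop :=
  forall c : chart M, smooth (coord_dom c) (g \o param M c).

Definition partition_of_unity (R : realType) (m : nat) (M : manifold R m)
    (N : nat) (c : 'I_N -> chart M) (rho : 'I_N -> M -> R) : Prop :=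
  [/\ forall j, smooth_function (rho j),
      forall j x, 0 <= rho j x,
      forall j, closure [set x | rho j x != 0] `<=` dom M (c j) &
      forall x, \sum_j rho j x = 1].

(* I is the integral of g omega^n over the compact manifold M, oriented by
   omega^n; this orientation is the reason for the absolute value, so that the
   charts need not be oriented. *)
Definition is_integral (R : realType) (n : nat) (M : manifold R n.*2)
    (omega : two_form M) (g : M -> R) (I : R) : Prop :=
  exists (N : nat) (c : 'I_N -> chart M) (rho : 'I_N -> M -> R),
    partition_of_unity c rho /\
    I = \sum_j iterated_integral (fun u =>
          if `[< coord_dom (c j) u >] then
            let x := param M (c j) u in
            rho j x * g x * `|top_power (omega (c j) x)|
          else 0).

Definition time_dom (R : realType) (m : nat) (M : manifold R m)
    (c : chart M) : set 'rV[R]_(1 + m) :=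
  [set w : 'rV[R]_(1 + m) |
    lsubmx w 0 0 \in `[0, 1] /\ coord_dom c (rsubmx w)].

Definition smooth_time_function (R : realType) (m : nat) (M : manifold R m)
    (f : R -> M -> R) : Prop :=
  forall c : chart M,
    smooth_on (time_dom c)
      (fun w => f (lsubmx w 0 0) (param M c (rsubmx w))).

Definition smooth_time_map (R : realType) (m : nat) (M : manifold R m)
    (psi : R -> M -> M) : Prop :=
  {within [set p : R * M | p.1 \in `[0, 1]],
    continuous (fun p : R * M => psi p.1 p.2)} /\
  forall c d : chart M,
    let psi_c (w : 'rV[R]_(1 + m)) :=
      psi (lsubmx w 0 0) (param M c (rsubmx w)) in
    smooth_on (time_dom c `&` psi_c @^-1` dom M d) (coord M d \o psi_c).

(* iota_X omega = - dh, where X c x is the row of components of the vector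
   X(x) in the chart c. *)
Definition hamiltonian_field (R : realType) (m : nat) (M : manifold R m)
    (omega : two_form M) (h : M -> R) (X : chart M -> M -> 'rV[R]_m) : Prop :=
  forall (c : chart M) (x : M), dom M c x ->
    X c x *m omega c x =
    - \row_i ('D_(basis_vec R i) (h \o param M c) (coord M c x) : R).

(* d psi_t(x) / dt = X_t(psi_t(x)) for t in [0, 1], with one-sided derivatives
   at the endpoints. *)
Definition is_flow (R : realType) (m : nat) (M : manifold R m)
    (psi : R -> M -> M) (X : R -> chart M -> M -> 'rV[R]_m) : Prop :=
  forall (t : R) (c : chart M) (x : M), t \in `[0, 1] -> dom M c (psi t x) ->
    h^-1 *: (coord M c (psi (t + h) x) - coord M c (psi t x))
      @[h --> within [set h : R | t + h \in `[0, 1]] 0^'] -->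
    X t c (psi t x).

Definition hamiltonian_isotopy (R : realType) (n : nat)
    (M : manifold R n.*2) (omega : two_form M) (f : R -> M -> R)
    (psi : R -> M -> M) : Prop :=
  [/\ smooth_time_function f,
      forall t : R, t \in `[0, 1] -> is_integral omega (f t) 0,
      smooth_time_map psi,
      forall x, psi 0 x = x &
      exists X : R -> chart M -> M -> 'rV[R]_(n.*2),
        (forall t : R, t \in `[0, 1] -> hamiltonian_field omega (f t) (X t)) /\
        is_flow psi X].

Definition closed_hamiltonian_isotopy (R : realType) (n : nat)
    (M : manifold R n.*2) (omega : two_form M) (f : R -> M -> R)
    (psi : R -> M -> M) : Prop :=
  hamiltonian_isotopy omega f psi /\ forall x, psi 1 x = x.

Definition orbit_simplex (R : realType) (m : nat) (M : manifold R m)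
    (psi : R -> M -> M) (x : M) : simplex M 1 :=
  fun u => psi (u 0 ord_max) x.

Definition spans_orbit (R : realType) (m : nat) (M : manifold R m)
    (psi : R -> M -> M) (x : M) (S : chain M 2) : Prop :=
  smooth_chain S /\ eq_chain (boundary S) [:: (1, orbit_simplex psi x)].

Definition cexp (R : realType) (z : R[i]) : R[i] :=
  real_complex R (expR (complex.Re z)) * Complex (cos (complex.Im z)) (sin (complex.Im z)).

Definition kappa (R : realType) (n : nat) (M : manifold R n.*2)
    (omega : two_form M) (f : R -> M -> R) (psi : R -> M -> M) (x : M)
    (S : chain M 2) : R[i] :=
  let two_pi_i : R[i] := Complex 0 (2%:R * pi) in
  cexp (two_pi_i * real_complex R (integral_chain omega S) -
        two_pi_i * real_complex R
          (\int[lebesgue_measure]_(t in `[0, 1]%classic) f t (psi t x))).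

(* Main.v *)
From HB Require Import structures.
Require Import Defs.
From mathcomp Require Import all_boot all_order all_algebra complex.
From mathcomp Require Import all_classical all_reals all_analysis.
From mathcomp Require Import ring lra.
Import Defs.

Set Implicit Arguments.
Unset Strict Implicit.
Unset Printing Implicit Defensive.

Import Order.TTheory GRing.Theory Num.Theory.
Import numFieldNormedType.Exports.

Local Open Scope classical_set_scope.
Local Open Scope ring_scope.

(** Integrality of omega provides an integer cochain z and a real cochain b
    such that the integral of omega over a smooth 2-simplex s is
    z(s) + (delta b)(s).  Summing over a chain S whose boundary is the orbit
    gamma_x of x gives int_S omega = b(gamma_x) modulo integers
    ([integral_spanning_chain]), so that kappa_x = exp(2 i pi h(x)) with
    h(x) = b(gamma_x) - int_0^1 f_t(psi_t x) dt.  It remains to see that h is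
    constant modulo integers; as M is connected, it is enough to compare two
    points x and y in a small ball of a chart
    ([connected_locally_congruent]).

    The segment sigma from x to y in that chart sweeps the rectangle
    (t, r) |-> psi_t(sigma(r)), which a diagonal cuts into two smooth
    triangles.  In the difference of their boundaries the diagonals cancel, and
    so do the sides t = 0 and t = 1, because psi_0 = psi_1 = id; what is left
    is gamma_x - gamma_y ([coboundary_prism]).  On the other hand
    omega(d/dt, d/dr) = omega(X_t, d/dr) = - d/dr f_t(psi_t(sigma(r))), so
    integrating in r first turns the integral of omega over the rectangle into
    int_0^1 (f_t(psi_t x) - f_t(psi_t y)) dt ([integral_prism]).  Comparing
    the two computations, h(x) - h(y) is the difference of the values of z on
    the two triangles, an integer.

    The vertices of the triangles are numbered so that time depends only on
    the outer one of the two variables of integration: each inner integral is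
    then an instance of the fundamental theorem of calculus, and what remains
    are integrals over [0, 1] that cancel along the diagonal.  The chain rules
    behind the formula for omega(d/dt, d/dr) rest on the differentiability of
    C^1 functions, smoothness being expressed by partial derivatives. *)

(** * Differentiability of functions with continuous partial derivatives *)

Lemma is_derive_line (R : realType) (V W : normedModType R) (f : V -> W)
    (y v : V) (s : R) : derivable f (y + s *: v) v ->
  is_derive s 1 (fun r : R => f (y + r *: v)) ('D_v f (y + s *: v)).
Proof.
move=> fd.
have E : (fun h : R => h^-1 *:
       (((fun r : R => f (y + r *: v)) \o shift s) (h *: 1) - f (y + s *: v))) =
   (fun h : R => h^-1 *: ((f \o shift (y + s *: v)) (h *: v) - f (y + s *: v))).
  apply/funext => h /=; congr (_ *: (f _ - _)).
  by rewrite [h%:A]mulr1 scalerDl addrCA.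
by split; rewrite ?/derivable ?/derive E.
Qed.

(** The restriction of g to a coordinate line is a function of one real
    variable, to which the mean value theorem applies. *)
Lemma coord_MVT (R : realType) (a : nat) (g : 'rV[R]_a -> R) (y : 'rV[R]_a)
    (i : 'I_a) (s e : R) :
  (forall r : R, `|r| <= `|s| ->
     derivable g (y + r *: basis_vec R i) (basis_vec R i) /\
     `|'D_(basis_vec R i) g (y + r *: basis_vec R i)| <= e) ->
  `|g (y + s *: basis_vec R i) - g y| <= e * `|s|.
Proof.
move=> H; set v := basis_vec R i in H *.
have D (r : R) : `|r| <= `|s| ->
    is_derive r 1 (fun r : R => g (y + r *: v)) ('D_v g (y + r *: v)).
  by move=> /H[d _]; exact: is_derive_line.
have C (r : R) : `|r| <= `|s| ->
    {for r, continuous (fun r : R => g (y + r *: v))}.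
  move=> /D[d _].
  exact/differentiable_continuous/derivable1_diffP.
rewrite -[X in g _ - g X]addr0 -[X in _ - g (_ + X)](scale0r v).
have [s0|s0] := leP 0 s.
  have ls r : r \in `[0, s]%R -> `|r| <= `|s|.
    by rewrite in_itv/= => /andP[r0 rs]; rewrite !ger0_norm.
  have [|c /ls cs ->] := @MVT_segment R _ _ 0 s s0
    (fun r rs => D r (ls r (subset_itv_oo_cc rs))).
    by apply: continuous_in_subspaceT => r /[!inE] rs; exact/C/ls.
  by rewrite subr0 normrM ler_wpM2r//; have [] := H _ cs.
have ls r : r \in `[s, 0]%R -> `|r| <= `|s|.
  by rewrite in_itv/= => /andP[r0 rs]; rewrite !ler0_norm ?lerN2// ltW.
have [|c /ls cs E] := @MVT_segment R _ _ s 0 (ltW s0)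
    (fun r rs => D r (ls r (subset_itv_oo_cc rs))).
  by apply: continuous_in_subspaceT => r /[!inE] rs; exact/C/ls.
by rewrite distrC E sub0r normrM normrN ler_wpM2r//; have [] := H _ cs.
Qed.

Lemma norm_row_coord (R : realType) (a : nat) (h : 'rV[R]_a) (i : 'I_a) :
  `|h 0 i| <= `|h|.
Proof.
rewrite [leRHS]/Num.Def.normr/= mx_normrE.
exact: (le_bigmax _ (fun ij : 'I_1 * 'I_a => `|h ij.1 ij.2|) (0, i)).
Qed.

Lemma norm_row_le (R : realType) (a : nat) (h k : 'rV[R]_a) :
  (forall i, `|h 0 i| <= `|k|) -> `|h| <= `|k|.
Proof.
move=> H; rewrite [leLHS]/Num.Def.normr/= mx_normrE.
by apply: bigmax_le => // -[i j] _ /=; rewrite (ord1 i).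
Qed.

(** Going from x to x + h one coordinate at a time stays within distance |h|
    of x, and each of the a steps is controlled by [coord_MVT]. *)
Lemma small_partials_lipschitz (R : realType) (a : nat) (g : 'rV[R]_a -> R)
    (x h : 'rV[R]_a) (e : R) :
  (forall k, `|k| <= `|h| -> forall i,
     derivable g (x + k) (basis_vec R i) /\
     `|'D_(basis_vec R i) g (x + k)| <= e) ->
  `|g (x + h) - g x| <= e * `|h| *+ a.
Proof.
move=> H.
(* The k-th point of the broken line from x to x + h is x + tr k. *)
pose tr (k : nat) : 'rV[R]_a := \row_i (if (i < k)%N then h 0 i else 0).
have trS (i : 'I_a) : tr i.+1 = tr i + h 0 i *: basis_vec R i.
  apply/rowP => j; rewrite !mxE eqxx/= ltnS leq_eqVlt.
  have [ij|ij] := eqVneq j i; first by rewrite ij eqxx ltnn mulr1 add0r.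
  by rewrite (negbTE (ij : nat_of_ord j != nat_of_ord i)) mulr0 addr0.
have -> : h = tr a by apply/rowP => i; rewrite !mxE ltn_ord.
have tr0 : tr 0%N = 0 by apply/rowP => i; rewrite !mxE ltn0.
rewrite -[X in g _ - g X]addr0 -tr0 -(telescope_sumr (fun k => g (x + tr k)))//.
rewrite big_mkord (le_trans (ler_norm_sum _ _ _))//.
rewrite -[X in _ *+ X]card_ord -sumr_const; apply: ler_sum => i _.
rewrite trS addrA.
have trh : `|tr a| = `|h| by congr (`|_|); apply/rowP => j; rewrite !mxE ltn_ord.
have e0 : 0 <= e.
  by have [|_ /(le_trans _)->//] := H 0 _ i; rewrite normr0.
apply: (@le_trans _ _ (e * `|h 0 i|)); last first.
  by rewrite trh ler_wpM2l// norm_row_coord.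
apply: coord_MVT => r rh; rewrite -addrA; apply: H.
apply: norm_row_le => j; rewrite !mxE eqxx/=.
have [ij|ij] := eqVneq j i.
  by rewrite ij ltnn add0r mulr1 (le_trans rh)// norm_row_coord.
rewrite mulr0 addr0; case: ifP; rewrite ?normr0// => _.
exact: norm_row_coord.
Qed.

(** Near x, the partial derivatives of g minus the candidate differential L
    are small by continuity, so [small_partials_lipschitz] makes this
    difference o(h). *)
Lemma C1_scalar_differentiable (R : realType) (a : nat) (U : set 'rV[R]_a)
    (g : 'rV[R]_a -> R) (x : 'rV[R]_a) :
  open U -> U x -> Ck 1 U g -> differentiable g x.
Proof.
move=> oU Ux [_ Hg].
pose l (i : 'I_a) : R := 'D_(basis_vec R i) g x.
pose L (h : 'rV[R]_a) : R := \sum_i h 0 i * l i.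
have L_lin : linear L.
  move=> k u v; rewrite /L scaler_sumr -big_split/=; apply: eq_bigr => i _.
  by rewrite !mxE mulrDl -mulrA.
pose LM := GRing.isLinear.Build _ _ _ _ _ L_lin.
pose Ll : {linear 'rV[R]_a -> R} := HB.pack L LM.
have Ll_diff y : differentiable Ll y.
  have -> : (Ll : _ -> _) = \sum_i (fun h : 'rV[R]_a => h 0 i * l i).
    by apply/funext => h; rewrite fct_sumE.
  apply: differentiable_sum => i; apply: differentiableM => //.
  exact: differentiable_coord.
have Ll_cont : continuous Ll by move=> y; exact/differentiable_continuous.
have Hdiff : g \o shift x =
    (cst (g x) : 'rV[R]_a -> R^o) + (Ll : 'rV[R]_a -> R^o) +o_ (0 : 'rV[R]_a) id.
  apply/eqaddoP => _/posnumP[e].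
  have a1 : 0 < (a.+1%:R : R) by rewrite ltr0n.
  have : \forall y \near x, forall i, U y /\
      `|'D_(basis_vec R i) g y - l i| <= e%:num / a.+1%:R.
    apply: (@filter_forall _ _ (fun i y => U y /\
      `|'D_(basis_vec R i) g y - l i| <= e%:num / a.+1%:R)
      (nbhs x) (nbhs_filter x)) => i.
    near=> y; split.
      by near: y; exact: open_nbhs_nbhs.
    rewrite distrC; near: y; have [_ [/(_ x Ux)/cvgrPdist_le Hc _]] := Hg i.
    by apply: Hc; rewrite divr_gt0.
  move=> /nbhs_ballP[r /= r0 Hr].
  near=> h.
  have hr : `|h| < r.
    near: h; apply/nbhs_ballP; exists r => //= h.
    by rewrite -ball_normE/= sub0r normrN.
  rewrite /= /cst !fctE/=.
  have Lh : L (x + h) = L x + L h.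
    by rewrite -[X in L (X + _)](scale1r x) L_lin [1 *: _]mul1r.
  (* The remainder is the increment of g - L, whose partials are small. *)
  have -> : g (h + x) - (g x + L h) = (g \- Ll) (x + h) - (g \- Ll) x.
    by rewrite /= [h + x]addrC Lh; ring.
  have K (k : 'rV[R]_a) : `|k| <= `|h| -> forall i,
     derivable (g \- Ll) (x + k) (basis_vec R i) /\
     `|'D_(basis_vec R i) (g \- Ll) (x + k)| <= e%:num / a.+1%:R.
    move=> kh i.
    have /Hr/(_ i)[Uy Hy] : ball x r (x + k).
      by rewrite -ball_normE/= opprD addNKr normrN (le_lt_trans kh).
    have dg : derivable g (x + k) (basis_vec R i).
      by have [H1 _] := Hg i; exact: H1.
    have dL : derivable Ll (x + k) (basis_vec R i) by exact: diff_derivable.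
    have -> : 'D_(basis_vec R i) (g \- Ll) (x + k) =
              'D_(basis_vec R i) g (x + k) - l i.
      rewrite deriveB// (deriveE _ (Ll_diff _)) diff_lin//=.
      congr (_ - _).
      rewrite /L (bigD1 i)//= big1; last first.
        by move=> j ji; rewrite mxE (negbTE ji) andbF mul0r.
      by rewrite mxE !eqxx mul1r addr0.
    by split => //; exact: derivableB.
  apply: (le_trans (small_partials_lipschitz K)).
  rewrite -mulr_natr mulrAC; apply: ler_wpM2r => //.
  rewrite -mulrA ger_pMr// mulrC ler_pdivrMr// mul1r ler_nat.
  exact: leqnSn.
apply/diff_locallyP; rewrite (diff_unique Ll_cont Hdiff); split => //.
Unshelve. all: by end_near. Qed.

(** * Algebra of C^k functions *)

Lemma CkW (R : realType) (a : nat) (W : normedModType R) (k : nat)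
    (U : set 'rV[R]_a) (g : 'rV[R]_a -> W) : Ck k.+1 U g -> Ck k U g.
Proof.
elim: k g => [|k IH] g [cg Hg]; split => // i.
by have [dg /IH] := Hg i.
Qed.

Lemma Ck_subset (R : realType) (a : nat) (W : normedModType R) (k : nat)
    (U V : set 'rV[R]_a) (g : 'rV[R]_a -> W) : U `<=` V -> Ck k V g -> Ck k U g.
Proof.
move=> UV; elim: k g => [|k IH] g [cg Hg]; split => //; first by move=> x /UV/cg.
  by move=> x /UV/cg.
by move=> i; have [dg /IH ?] := Hg i; split => // x /UV/dg.
Qed.

(** Openness of U matters: the derivatives at a point of U see g on a whole
    neighborhood. *)
Lemma Ck_ext (R : realType) (a : nat) (W : normedModType R) (k : nat)
    (U : set 'rV[R]_a) (g h : 'rV[R]_a -> W) :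
  open U -> {in U, g =1 h} -> Ck k U g -> Ck k U h.
Proof.
move=> oU; elim: k g h => [|k IH] g h gh [cg Hg].
all: have nU x : U x -> \forall y \near x, U y by move=> Ux; exact: open_nbhs_nbhs.
all: have ngh x : U x -> \forall y \near x, g y = h y
  by move=> /nU; apply: filterS => y Uy; apply: gh; rewrite inE.
all: have ch x : U x -> {for x, continuous h}
  by move=> Ux; rewrite /prop_for /continuous_at -gh ?inE//;
     apply: cvg_trans (cg x Ux);
     exact: (@near_eq_cvg _ _ (nbhs x) (nbhs_filter x) _ _ (ngh x Ux)).
  by split.
split => // i; have [dg Cg] := Hg i; split.
  by move=> x Ux; exact: (near_eq_derivable (ngh x Ux) (dg x Ux)).
by apply: IH Cg => x /[!inE] Ux; exact: near_eq_derive (ngh x Ux).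
Qed.

Lemma Ck_cst (R : realType) (a : nat) (W : normedModType R) (k : nat)
    (U : set 'rV[R]_a) (w : W) : Ck k U (fun _ => w).
Proof.
elim: k w => [|k IH] w; split => //; try by move=> x _; exact: cst_continuous.
move=> i; split; first by move=> y _; exact: (derivable_cst w y).
suff -> : 'D_(basis_vec R i) (fun _ => w) = (fun _ => 0) by exact: IH.
by apply/funext => x; exact: derive_cst.
Qed.

Lemma CkD (R : realType) (a : nat) (W : normedModType R) (k : nat)
    (U : set 'rV[R]_a) (g h : 'rV[R]_a -> W) :
  open U -> Ck k U g -> Ck k U h -> Ck k U (fun x => g x + h x).
Proof.
move=> oU; elim: k g h => [|k IH] g h [cg Hg] [ch Hh]; split => //.
- by move=> x Ux; apply: continuousD; [exact: cg|exact: ch].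
- by move=> x Ux; apply: continuousD; [exact: cg|exact: ch].
move=> i; have [dg Cg] := Hg i; have [dh Ch] := Hh i; split.
  by move=> x Ux; apply: derivableD; [exact: dg|exact: dh].
apply: Ck_ext (IH _ _ Cg Ch) => // x /[!inE] Ux.
by rewrite -deriveD//; [exact: dg|exact: dh].
Qed.

Lemma CkZ (R : realType) (a : nat) (W : normedModType R) (k : nat)
    (U : set 'rV[R]_a) (r : R) (g : 'rV[R]_a -> W) :
  open U -> Ck k U g -> Ck k U (fun x => r *: g x).
Proof.
move=> oU; elim: k g => [|k IH] g [cg Hg]; split => //.
- by move=> x Ux; exact: continuousZ (@cst_continuous _ _ r x) (cg x Ux).
- by move=> x Ux; exact: continuousZ (@cst_continuous _ _ r x) (cg x Ux).
move=> i; have [dg Cg] := Hg i; split.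
  by move=> x Ux; apply: derivableZ; exact: dg.
apply: Ck_ext (IH _ Cg) => // x /[!inE] Ux.
by rewrite -deriveZ//; exact: dg.
Qed.

Lemma Ck_sum (R : realType) (a : nat) (W : normedModType R) (k : nat)
    (U : set 'rV[R]_a) (I : Type) (s : seq I) (g : I -> 'rV[R]_a -> W) :
  open U -> (forall i, Ck k U (g i)) -> Ck k U (fun x => \sum_(i <- s) g i x).
Proof.
move=> oU H; elim: s => [|i s IH].
  rewrite (_ : (fun x => _) = (fun _ => 0)); first exact: Ck_cst.
  by apply/funext => x; rewrite big_nil.
rewrite (_ : (fun x => _) = (fun x => g i x + \sum_(i <- s) g i x)).
  exact: CkD.
by apply/funext => x; rewrite big_cons.
Qed.

Lemma C1_coord (R : realType) (a m : nat) (U : set 'rV[R]_a)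
    (g : 'rV[R]_a -> 'rV[R]_m) (j : 'I_m) :
  open U -> Ck 1 U g -> Ck 1 U (fun x => g x 0 j : R).
Proof.
move=> oU [cg Hg]; pose cj (N : 'rV[R]_m) : R := N 0 j.
have ccj N : {for N, continuous cj}.
  exact/differentiable_continuous/differentiable_coord.
split; first by move=> x Ux; exact: continuous_comp (cg x Ux) (ccj _).
move=> i; have [dg [cdg _]] := Hg i; split.
  by move=> x Ux; have /derivable_mxP := dg x Ux.
apply: (@Ck_ext _ _ _ _ _ (fun x => ('D_(basis_vec R i) g x) 0 j)) => //.
  by move=> x /[!inE] Ux; rewrite derive_mx ?mxE//; exact: dg.
by split=> // x Ux; exact: continuous_comp (cdg x Ux) (ccj _).
Qed.

Lemma C1_row_differentiable (R : realType) (a m : nat) (U : set 'rV[R]_a)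
    (g : 'rV[R]_a -> 'rV[R]_m) (x : 'rV[R]_a) :
  open U -> U x -> Ck 1 U g -> differentiable g x.
Proof.
move=> oU Ux Cg.
have -> : g = \sum_j (fun y => (g y 0 j : R) *: basis_vec R j).
  by apply/funext => y; rewrite fct_sumE [LHS]row_sum_delta.
apply: differentiable_sum => j; apply: differentiableZl.
by apply: (@C1_scalar_differentiable _ _ U) => //; exact: C1_coord.
Qed.

Lemma row_linear_differentiable (R : realType) (a : nat) (W : normedModType R)
    (L : {linear 'rV[R]_a -> W}) (x : 'rV[R]_a) : differentiable L x.
Proof.
have -> : (L : _ -> _) =
    \sum_j (fun y : 'rV[R]_a => (y 0 j : R) *: L (basis_vec R j)).
  apply/funext => y; rewrite fct_sumE [in LHS](row_sum_delta y) linear_sum.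
  by apply: eq_bigr => i _; rewrite linearZ.
apply: differentiable_sum => j; apply: differentiableZl.
exact: differentiable_coord.
Qed.

Lemma mulmxr_row_continuous (R : realType) (a b : nat) (A : 'M[R]_(a, b)) :
  continuous (mulmxr A : 'rV[R]_a -> 'rV[R]_b).
Proof.
by move=> x; exact/differentiable_continuous/row_linear_differentiable.
Qed.

(** This turns any directional derivative into partial derivatives, the only
    ones that [Ck] controls. *)
Lemma derive_coords (R : realType) (a : nat) (W : normedModType R)
    (g : 'rV[R]_a -> W) (x v : 'rV[R]_a) : differentiable g x ->
  'D_v g x = \sum_i v 0 i *: 'D_(basis_vec R i) g x.
Proof.
move=> dg; rewrite deriveE// [in LHS](row_sum_delta v) linear_sum.
by apply: eq_bigr => i _; rewrite linearZ/= deriveE.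
Qed.

Lemma derive_comp_linear (R : realType) (V V' W : normedModType R)
    (L : {linear V -> V'}) (g : V' -> W) (x v : V) :
  'D_v (g \o L) x = 'D_(L v) g (L x).
Proof.
have E : (fun h : R => h^-1 *: (((g \o L) \o shift x) (h *: v) - (g \o L) x)) =
         (fun h : R => h^-1 *: ((g \o shift (L x)) (h *: L v) - g (L x))).
  by apply/funext => h /=; rewrite linearP.
by rewrite /derive E.
Qed.

(** By the chain rule the partial derivatives of g(w *m A) are linear
    combinations of those of g at w *m A, to which the induction hypothesis
    applies; the combination formula needs g to be differentiable. *)
Lemma Ck_comp_linear (R : realType) (a b m k : nat) (U : set 'rV[R]_b)
    (A : 'M[R]_(a, b)) (g : 'rV[R]_b -> 'rV[R]_m) :
  open U -> Ck k U g -> Ck k [set w | U (w *m A)] (fun w => g (w *m A)).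
Proof.
move=> oU.
have cA := mulmxr_row_continuous (A := A).
have oUA : open [set w | U (w *m A)].
  by have /continuousP/(_ U oU) := cA.
elim: k g => [|k IH] g Cg.
  split=> // x Ux; apply: (@continuous_comp _ _ _ (mulmxr A) g); first exact: cA.
  by have [cg _] := Cg; exact: cg.
have dg x : U x -> differentiable g x.
  move=> Ux; apply: (C1_row_differentiable oU Ux).
  by elim: {IH} k Cg => // k IH /CkW.
split.
  move=> x Ux; apply: (@continuous_comp _ _ _ (mulmxr A) g); first exact: cA.
  by have [cg _] := Cg; exact: cg.
move=> i; split.
  move=> x Ux; apply: diff_derivable.
  apply: (@differentiable_comp _ _ _ _ (mulmxr A) g); last exact: dg.
  exact: row_linear_differentiable.
apply: (@Ck_ext _ _ _ _ _ (fun w => \sum_(j <- enum 'I_b)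
    (basis_vec R i *m A) 0 j *: 'D_(basis_vec R j) g (w *m A))) => //.
  move=> x /[!inE] Ux; rewrite big_enum/=.
  rewrite -derive_coords; last exact: dg.
  by rewrite -(derive_comp_linear (mulmxr A)).
apply: Ck_sum => // j.
apply: (@CkZ _ _ _ _ _ _ (fun w => 'D_(basis_vec R j) g (w *m A))) => //.
by have [_ /(_ j)[_ Dg]] := Cg; exact: IH Dg.
Qed.

(** * Evaluating cochains on chains *)

Definition chain_eval (R : realType) (m : nat) (M : manifold R m) (k : nat)
    (A : zmodType) (z : simplex M k -> A) (S : chain M k) : A :=
  \sum_(p <- S) z p.2 *~ p.1.

Lemma eq_simplex_sym (R : realType) (m : nat) (M : manifold R m) (k : nat)
    (s s' : simplex M k) : eq_simplex s s' -> eq_simplex s' s.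
Proof. by move=> H u /H. Qed.

Lemma eq_simplex_trans (R : realType) (m : nat) (M : manifold R m) (k : nat)
    (s s' s'' : simplex M k) :
  eq_simplex s s' -> eq_simplex s' s'' -> eq_simplex s s''.
Proof. by move=> H H' u Hu; rewrite H ?H'. Qed.

(** A chain is a list in which a simplex may occur several times, under
    representatives that agree only on the standard simplex.  Removing all the
    occurrences of the class of the first one removes a multiple of its
    coefficient, hence zero, and leaves the other coefficients unchanged. *)
Lemma chain_eval_zero (R : realType) (m : nat) (M : manifold R m) (k : nat)
    (A : zmodType) (z : simplex M k -> A) (S : chain M k) :
  is_cochain z -> (forall s, chain_coef S s = 0) -> chain_eval z S = 0.
Proof.
move=> hz; have [N] := ubnP (size S); elim: N S => // N IH [|p S] SN S0.
  by rewrite /chain_eval big_nil.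
pose P (q : int * simplex M k) := `[< eq_simplex q.2 p.2 >].
rewrite /chain_eval (bigID P)/=.
rewrite (eq_bigr (fun q => z p.2 *~ q.1)); last first.
  by move=> q /asboolP /hz ->.
rewrite -mulrz_sumr -/(chain_coef (p :: S) p.2) S0 mulr0z add0r.
rewrite -big_filter; apply: IH.
  rewrite /= /P asboolT//= (leq_ltn_trans _ (SN : (size S < N)%N))//.
  by rewrite size_filter count_size.
move=> s; rewrite /chain_coef big_filter_cond.
have [sp|nsp] := pselect (eq_simplex s p.2).
  rewrite big_pred0// => q; apply/negP => /andP[/asboolP qp /asboolP qs].
  by apply: qp; exact: eq_simplex_trans qs sp.
rewrite -[RHS](S0 s) /chain_coef; apply: eq_bigl => q.
case: asboolP => [qs|]; rewrite ?andbF// andbT /P.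
by apply/asboolP => qp; apply/nsp/(eq_simplex_trans _ qp)/eq_simplex_sym.
Qed.

Lemma chain_eval_eq (R : realType) (m : nat) (M : manifold R m) (k : nat)
    (A : zmodType) (z : simplex M k -> A) (S S' : chain M k) :
  is_cochain z -> eq_chain S S' -> chain_eval z S = chain_eval z S'.
Proof.
move=> hz SS'; apply/eqP; rewrite -subr_eq0; apply/eqP.
pose opp : chain M k := [seq (- p.1, p.2) | p <- S'].
have <- : chain_eval z (S ++ opp) = chain_eval z S - chain_eval z S'.
  rewrite /chain_eval big_cat big_map/=; congr (_ + _).
  by rewrite -sumrN; apply: eq_bigr => q _; rewrite mulrNz.
apply: chain_eval_zero => // s.
by rewrite /chain_coef big_cat big_map/= sumrN -!/(chain_coef _ _) SS' subrr.
Qed.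

(** Discrete Stokes: the coboundary is the transpose of the boundary. *)
Lemma chain_eval_boundary (R : realType) (m : nat) (M : manifold R m) (k : nat)
    (A : zmodType) (z : simplex M k -> A) (S : chain M k.+1) :
  chain_eval z (boundary S) = chain_eval (coboundary z) S.
Proof.
rewrite /chain_eval /boundary big_allpairs_dep; apply: eq_bigr => p _.
rewrite big_enum/= /coboundary mulrz_suml; apply: eq_bigr => i _.
by rewrite mulrzA.
Qed.

(** Modulo integers the integral of omega over S depends only on the boundary
    of S, through the cochain b. *)
Lemma integral_spanning_chain (R : realType) (m : nat) (M : manifold R m)
    (omega : two_form M) (z : simplex M 2 -> int) (b : simplex M 1 -> R)
    (psi : R -> M -> M) (x : M) (S : chain M 2) :
  is_cochain b ->
  (forall s : simplex M 2, smooth_simplex s ->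
     integral_simplex omega s = (z s)%:~R + coboundary b s) ->
  spans_orbit psi x S ->
  integral_chain omega S = (chain_eval z S)%:~R + b (orbit_simplex psi x).
Proof.
move=> hb H [sS bS].
have -> : b (orbit_simplex psi x) = chain_eval (coboundary b) S.
  by rewrite -chain_eval_boundary (chain_eval_eq hb bS) /chain_eval big_seq1.
rewrite /chain_eval mulrz_sumr -big_split/=.
rewrite /integral_chain [LHS]big_seq [RHS]big_seq; apply: eq_bigr => p pS.
have /allP/(_ p pS)/asboolP/H -> := sS.
by rewrite mulrDr mulrzz intrM mulrC; congr (_ + _); rewrite mulrzl.
Qed.

(** * The isotopy read in a chart, and its affine simplices *)

Lemma continuous_within_comp (T U V : topologicalType) (A : set T) (B : set U)
    (f : T -> U) (g : U -> V) : (forall x, A x -> B (f x)) ->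
  {within A, continuous f} -> {within B, continuous g} ->
  {within A, continuous (g \o f)}.
Proof.
move=> AB /subspace_continuousP cf /subspace_continuousP cg.
apply/subspace_continuousP => x Ax W /(cg _ (AB x Ax)) /(cf x Ax).
by rewrite /nbhs/= /within/=; apply: filterS => y H Ay; apply: (H Ay); exact: AB.
Qed.

Lemma continuous_within_for (T U : topologicalType) (A : set T) (f : T -> U) :
  (forall x, A x -> {for x, continuous f}) -> {within A, continuous f}.
Proof.
move=> cf; apply/subspace_continuousP => x Ax.
by apply: cvg_within_filter; exact: cf.
Qed.

Section manifold_lemmas.
Context (R : realType) (m : nat) (M : manifold R m).
Implicit Types (c d : chart M) (psi : R -> M -> M) (f : R -> M -> R).

Lemma coord_continuous_at c (x : M) :
  dom M c x -> {for x, continuous (coord M c)}.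
Proof.
move=> cx; have := @coord_continuous _ _ M c.
rewrite continuous_open_subspace; last exact: open_dom.
by apply; rewrite inE.
Qed.

Lemma param_continuous_at c (z : 'rV[R]_m) :
  coord_dom c z -> {for z, continuous (param M c)}.
Proof.
move=> cz; have := @param_continuous _ _ M c.
rewrite continuous_open_subspace; last exact: open_coord.
by apply; rewrite inE.
Qed.

Lemma coord_domP c (x : M) : dom M c x -> coord_dom c (coord M c x).
Proof. by move=> cx; exists x. Qed.

(** The source is 'rV_(1 + m): the first coordinate is time, the others are
    the coordinates of the initial point in the chart c. *)
Definition isotopy_chart psi c (w : 'rV[R]_(1 + m)) : M :=
  psi (lsubmx w 0 0) (param M c (rsubmx w)).

(** The open part of [time_dom], where two-sided derivatives make sense. *)
Definition inner_time_dom c : set 'rV[R]_(1 + m) :=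
  [set w | (lsubmx w 0 0 \in `]0, 1[) /\ coord_dom c (rsubmx w)].

Lemma inner_time_domW c : inner_time_dom c `<=` time_dom c.
Proof. by move=> w [tw cw]; split => //; exact: subset_itv_oo_cc. Qed.

Lemma time_continuous : continuous (fun w : 'rV[R]_(1 + m) => lsubmx w 0 0 : R).
Proof.
move=> w; apply: (@continuous_comp _ _ _ (@lsubmx R 1 1 m)
  (fun N : 'M[R]_1 => N 0 0)).
  exact: continuous_lsubmx.
exact/differentiable_continuous/differentiable_coord.
Qed.

Lemma open_inner_time_dom c : open (inner_time_dom c).
Proof.
apply: openI.
  have /continuousP := time_continuous.
  by move=> /(_ `]0, 1[%classic); apply; exact: interval_open.
have /continuousP := @continuous_rsubmx R 1 1 m.
by apply; exact: open_coord.
Qed.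

Lemma isotopy_chart_continuous psi c : smooth_time_map psi ->
  {within time_dom c, continuous (isotopy_chart psi c)}.
Proof.
move=> [cpsi _].
apply: (@continuous_within_comp _ _ _ _ _
  (fun w : 'rV[R]_(1 + m) => (lsubmx w 0 0 : R, param M c (rsubmx w)))
  _ _ _ cpsi).
  by move=> w [].
apply: continuous_within_for => w [_ cw].
have cp : {for w, continuous (fun w => param M c (rsubmx w))}.
  apply: (@continuous_comp _ _ _ (@rsubmx R 1 1 m) (param M c)).
    exact: continuous_rsubmx.
  exact: param_continuous_at.
exact: cvg_pair (@time_continuous w) cp.
Qed.

Lemma isotopy_chart_continuous_at psi c w : smooth_time_map psi ->
  inner_time_dom c w -> {for w, continuous (isotopy_chart psi c)}.
Proof.
move=> spsi bw.
have : {within inner_time_dom c, continuous (isotopy_chart psi c)}.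
  have cpsi := @isotopy_chart_continuous _ c spsi.
  exact: (continuous_subspaceW (@inner_time_domW c) cpsi).
rewrite continuous_open_subspace; last exact: open_inner_time_dom.
by apply; rewrite inE.
Qed.

(** The simplex that is affine in time and in the chart c, with vertices the
    rows of A, followed by the isotopy.  The barycentric coordinates sum to 1 on
    the standard simplex, so the linear map u |-> u *m A is enough. *)
Definition affine_simplex psi c (k : nat) (A : 'M[R]_(k.+1, 1 + m)) :
    simplex M k :=
  fun u => isotopy_chart psi c (u *m A).

Lemma smooth_affine_simplex psi c k (A : 'M[R]_(k.+1, 1 + m)) :
  smooth_time_map psi ->
  (forall u, std_simplex R k u -> time_dom c (u *m A)) ->
  smooth_simplex (affine_simplex psi c A).
Proof.
move=> spsi HA; split.
  apply: (continuous_within_comp HA); last exact: isotopy_chart_continuous.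
  apply: continuous_within_for => u _.
  exact: mulmxr_row_continuous.
move=> d u [Su du]; have [_ /(_ c d)] := spsi.
move=> /(_ (u *m A) (conj (HA u Su) du))[U [h [oU Uu sh hE]]].
exists [set u | U (u *m A)], (fun u => h (u *m A)); split => //.
- by have /continuousP/(_ U oU) := mulmxr_row_continuous (A := A).
- by move=> l; apply: Ck_comp_linear.
- by move=> y [[Sy dy] Uy]; rewrite hE//; split => //; split => //; exact: HA.
Qed.

End manifold_lemmas.

(** * Derivatives of the Hamiltonian along the isotopy *)

(** At an interior point, the local smooth extension agrees with g on a
    neighborhood, so g itself is smooth there. *)
Lemma smooth_on_interior (R : realType) (a : nat) (W : normedModType R)
    (A : set 'rV[R]_a) (g : 'rV[R]_a -> W) (x : 'rV[R]_a) :
  nbhs x A -> smooth_on A g ->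
  exists U, [/\ open U, U x, U `<=` A & smooth U g].
Proof.
move=> Ax sg; have [U [h [oU Ux sh hg]]] := sg x (nbhs_singleton Ax).
have oUA : open (U `&` interior A) by apply: openI => //; exact: open_interior.
have UA : U `&` interior A `<=` A by move=> y [_ /nbhs_singleton].
exists (U `&` interior A); split => // k.
apply: (@Ck_ext _ _ _ _ _ h) => //; last by apply: Ck_subset (sh k) => y [].
by move=> y /[!inE] /[dup] -[Uy _] /UA Ay; apply: hg.
Qed.

Lemma derive_row_mx (R : realType) (a n1 n2 : nat)
    (L : {linear 'rV[R]_a -> 'rV[R]_n1}) (K : 'rV[R]_a -> 'rV[R]_n2)
    (w v : 'rV[R]_a) :
  differentiable K w ->
  differentiable (fun w => row_mx (L w) (K w)) w /\
  'D_v (fun w => row_mx (L w) (K w)) w = row_mx (L v) ('D_v K w).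
Proof.
move=> dK.
pose L1 : {linear 'rV[R]_a -> 'rV[R]_(n1 + n2)} := mulmxr (row_mx 1%:M 0) \o L.
pose L2 : {linear 'rV[R]_n2 -> 'rV[R]_(n1 + n2)} := mulmxr (row_mx 0 1%:M).
have d1 x : differentiable L1 x by exact: row_linear_differentiable.
have d2 : differentiable (L2 \o K) w.
  by apply: differentiable_comp => //; exact: row_linear_differentiable.
have -> : (fun w => row_mx (L w) (K w)) =
    (L1 : 'rV[R]_a -> 'rV[R]_(n1 + n2)) + (L2 \o K).
  apply/funext => x; rewrite fctE /= !mul_mx_row !mulmx1 !mulmx0.
  by rewrite add_row_mx addr0 add0r.
split; first exact: differentiableD.
rewrite deriveD; [|exact: diff_derivable..].
rewrite deriveE// diff_lin; last by move=> x; exact: differentiable_continuous.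
rewrite [X in _ + X]deriveE// diff_comp//; last exact: row_linear_differentiable.
rewrite /= diff_lin; last first.
  by move=> x; exact/differentiable_continuous/row_linear_differentiable.
rewrite -deriveE// /= !mul_mx_row !mulmx1 !mulmx0.
by rewrite add_row_mx addr0 add0r.
Qed.

Lemma basis_vec_rshift (R : realType) (m : nat) (j : 'I_m) :
  basis_vec R (rshift 1 j) = row_mx 0 (basis_vec R j).
Proof.
apply/rowP => i; rewrite !mxE eqxx/=.
case: splitP => k ik; rewrite mxE.
  by rewrite -val_eqE/= ik ltn_eqF// (leq_trans (ltn_ord k))// leq_addr.
by rewrite -val_eqE/= ik eqn_add2l.
Qed.

Lemma C1_derive_continuous (R : realType) (a : nat) (W : normedModType R)
    (U : set 'rV[R]_a) (g : 'rV[R]_a -> W) (x v : 'rV[R]_a) :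
  open U -> U x -> (forall y, U y -> differentiable g y) -> Ck 1 U g ->
  {for x, continuous ('D_v g)}.
Proof.
move=> oU Ux dg [_ Cg]; suff [] : Ck 0 U ('D_v g) by move=> /(_ x Ux).
apply: (@Ck_ext _ _ _ _ _
  (fun y => \sum_(i <- enum 'I_a) v 0 i *: 'D_(basis_vec R i) g y)) => //.
  by move=> y /[!inE] /dg dgy; rewrite big_enum/= -derive_coords.
apply: (@Ck_sum _ _ _ _ _ _ _
  (fun i y => v 0 i *: 'D_(basis_vec R i) g y)) => // i.
by apply: CkZ => //; have [_ ?] := Cg i.
Qed.

Section energy.
Context (R : realType) (m : nat) (M : manifold R m).
Implicit Types (c d : chart M) (psi : R -> M -> M) (f : R -> M -> R).

Definition function_chart f c (w : 'rV[R]_(1 + m)) : R :=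
  f (lsubmx w 0 0) (param M c (rsubmx w)).

Definition energy f psi c (w : 'rV[R]_(1 + m)) : R :=
  f (lsubmx w 0 0) (isotopy_chart psi c w).

Definition isotopy_coord psi c d (w : 'rV[R]_(1 + m)) : 'rV[R]_m :=
  coord M d (isotopy_chart psi c w).

Lemma inner_time_dom_nbhs c w : inner_time_dom c w -> nbhs w (time_dom c).
Proof.
move=> bw; apply: (filterS (@inner_time_domW _ _ _ c)).
by apply: open_nbhs_nbhs; split => //; exact: open_inner_time_dom.
Qed.

Lemma isotopy_coord_smooth psi c d w : smooth_time_map psi ->
  inner_time_dom c w -> dom M d (isotopy_chart psi c w) ->
  exists U, [/\ open U, U w,
    U `<=` time_dom c `&` isotopy_chart psi c @^-1` dom M d &
    smooth U (isotopy_coord psi c d)].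
Proof.
move=> spsi bw dw; apply: smooth_on_interior; last by have [_ ] := spsi; exact.
apply: filterI; first exact: inner_time_dom_nbhs.
apply: (isotopy_chart_continuous_at spsi bw).
by apply: open_nbhs_nbhs; split => //; exact: open_dom.
Qed.

(** Near P the Hamiltonian along the isotopy is the composite of two smooth
    maps between open sets: the isotopy in charts, together with time, and the
    Hamiltonian in the target chart d. *)
Lemma energy_local f psi c d P :
  smooth_time_function f -> smooth_time_map psi ->
  inner_time_dom c P -> dom M d (isotopy_chart psi c P) ->
  let H (w : 'rV[R]_(1 + m)) : 'rV[R]_(1 + m) :=
    row_mx (lsubmx w) (isotopy_coord psi c d w) in
  exists U V, [/\ open U, U P, open V, smooth U (isotopy_coord psi c d) &
    smooth V (function_chart f d)] /\
    forall w, U w -> V (H w) /\ energy f psi c w = function_chart f d (H w).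
Proof.
move=> sf spsi bP dP H.
have [U [oU UP Usub sU]] := isotopy_coord_smooth spsi bP dP.
have bHP : inner_time_dom d (H P).
  split; rewrite ?row_mxKl ?row_mxKr; first by have [] := bP.
  exact: coord_domP.
have [V [oV VP _ sV]] := smooth_on_interior (inner_time_dom_nbhs bHP) (sf d).
have cH : {for P, continuous H}.
  have [] // := @derive_row_mx R (1 + m) 1 m lsubmx (isotopy_coord psi c d) P 0.
    exact: C1_row_differentiable (sU 1%N).
  by move=> /differentiable_continuous.
exists (U `&` interior (H @^-1` V)), V; split; first split => //.
- by apply: openI => //; exact: open_interior.
- by split=> //; apply: cH; exact: open_nbhs_nbhs.
- by move=> k; apply: Ck_subset (sU k) => y [].
move=> w [Uw /nbhs_singleton VHw]; split => //.
have [_ dw] := Usub w Uw.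
by rewrite /energy /function_chart /H row_mxKl row_mxKr /isotopy_coord coordK.
Qed.

(** Differentiating at fixed time (lsubmx v = 0) only involves the spatial
    partial derivatives of the Hamiltonian, that is, d f_t applied to the
    transported vector.  The formula holds on a neighborhood with the same
    target chart, whence the continuity. *)
Lemma energy_derive f psi c d P (v : 'rV[R]_(1 + m)) :
  smooth_time_function f -> smooth_time_map psi ->
  inner_time_dom c P -> dom M d (isotopy_chart psi c P) -> lsubmx v = 0 ->
  [/\ derivable (energy f psi c) P v,
      {for P, continuous ('D_v (energy f psi c))} &
      'D_v (energy f psi c) P = \sum_j ('D_v (isotopy_coord psi c d) P) 0 j *
        'D_(basis_vec R j) (f (lsubmx P 0 0) \o param M d)
          (isotopy_coord psi c d P)].
Proof.
move=> sf spsi bP dP v0.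
have [U [V [[oU UP oV sK sF] HUV]]] := energy_local sf spsi bP dP.
set K := isotopy_coord psi c d in sK HUV *.
set F := function_chart f d in sF HUV *.
pose H (w : 'rV[R]_(1 + m)) : 'rV[R]_(1 + m) := row_mx (lsubmx w) (K w).
have dK w : U w -> differentiable K w.
  by move=> Uw; exact: C1_row_differentiable (sK 1%N).
have dH w : U w -> differentiable H w.
  by move=> /dK /(@derive_row_mx R (1 + m) 1 m lsubmx K w v)[].
have DH w : U w -> 'D_v H w = row_mx 0 ('D_v K w).
  by move=> /dK /(@derive_row_mx R (1 + m) 1 m lsubmx K w v)[_ ->]/=; rewrite v0.
have dF w : U w -> differentiable F (H w).
  by move=> /HUV[VH _]; exact: C1_scalar_differentiable (sF 1%N).
have nE w : U w -> \forall w' \near w, (F \o H) w' = energy f psi c w'.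
  move=> Uw; have : nbhs w U by exact: open_nbhs_nbhs.
  by apply: filterS => w' /HUV[_ ->].
have dFH w : U w -> derivable (F \o H) w v.
  move=> Uw; apply: diff_derivable.
  by apply: differentiable_comp; [exact: dH|exact: dF].
(* The chain rule for F \o H, written with partial derivatives only, so that
   its continuity follows from that of the partials. *)
pose E' (w : 'rV[R]_(1 + m)) :=
  \sum_j ('D_v K w) 0 j * 'D_(basis_vec R (rshift 1 j)) F (H w).
have DE w : U w -> 'D_v (energy f psi c) w = E' w.
  move=> Uw; rewrite -(near_eq_derive _ (nE w Uw)).
  rewrite deriveE; last by apply: differentiable_comp; [exact: dH|exact: dF].
  rewrite diff_comp; [|exact: dH|exact: dF].
  rewrite /= -[in X in 'd F _ X]deriveE; last exact: dH.
  rewrite -deriveE; last exact: dF.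
  rewrite DH// derive_coords; last exact: dF.
  rewrite big_split_ord/= big_ord1 row_mxEl mxE scale0r add0r.
  by apply: eq_bigr => j _; rewrite row_mxEr.
have cE' : {for P, continuous E'}.
  have cH : {for P, continuous H} by apply: differentiable_continuous; exact: dH.
  have cDK : {for P, continuous ('D_v K)} by exact: C1_derive_continuous (sK 1%N).
  have cterm j : {for P, continuous (fun w => ('D_v K w) 0 j *
      'D_(basis_vec R (rshift 1 j)) F (H w) : R)}.
    apply: continuousM.
      apply: (@continuous_comp _ _ _ ('D_v K) (fun N : 'rV[R]_m => N 0 j)) => //.
      exact/differentiable_continuous/differentiable_coord.
    apply: (@continuous_comp _ _ _ H ('D_(basis_vec R (rshift 1 j)) F)) => //.
    have [_ /(_ (rshift 1 j))[_ [+ _]]] := sF 1%N.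
    by apply; have [] := HUV P UP.
  exact: (cvg_big (@add_continuous R^o) (nbhs_filter P) (fun j _ => cterm j)).
split.
- exact: near_eq_derivable (nE P UP) (dFH P UP).
- rewrite /prop_for /continuous_at DE//; apply: cvg_trans cE'.
  apply: (@near_eq_cvg _ _ (nbhs P) (nbhs_filter P)).
  have : nbhs P U by exact: open_nbhs_nbhs.
  by apply: filterS => w Uw; rewrite DE.
- rewrite DE//; apply: eq_bigr => j _; congr (_ * _).
  rewrite /derive.
  suff -> : (fun h : R => h^-1 *:
         ((F \o shift (H P)) (h *: basis_vec R (rshift 1 j)) - F (H P))) =
      (fun h : R => h^-1 *:
         (((f (lsubmx P 0 0) \o param M d) \o shift (K P)) (h *: basis_vec R j)
          - (f (lsubmx P 0 0) \o param M d) (K P))) by [].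
  apply/funext => h /=; congr (_ *: (_ - _)); rewrite /F /function_chart.
    rewrite basis_vec_rshift scale_row_mx add_row_mx row_mxKl row_mxKr.
    by rewrite scaler0 add0r.
  by rewrite row_mxKl row_mxKr.
Qed.
End energy.

(** * The density of omega on an affine triangle *)

Section time_point.
Context (R : realType) (m : nat).
Implicit Types (s t : R) (z : 'rV[R]_m).

Definition time_point t z : 'rV[R]_(1 + m) := row_mx t%:M z.

Lemma time_point_time t z : lsubmx (time_point t z) 0 0 = t.
Proof. by rewrite row_mxKl mxE eqxx mulr1n. Qed.

Lemma time_point_pos t z : rsubmx (time_point t z) = z.
Proof. exact: row_mxKr. Qed.

Lemma time_pointZ s t z : s *: time_point t z = time_point (s * t) (s *: z).
Proof. by rewrite /time_point scale_row_mx scale_scalar_mx. Qed.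

Lemma time_pointD s t z z' :
  time_point s z + time_point t z' = time_point (s + t) (z + z').
Proof. by rewrite /time_point add_row_mx raddfD. Qed.

Lemma time_pointB s t z z' :
  time_point s z - time_point t z' = time_point (s - t) (z - z').
Proof. by rewrite -scaleN1r time_pointZ time_pointD mulN1r scaleN1r. Qed.

Lemma continuous_time_point (T : topologicalType) (x : T) (a : T -> R)
    (g : T -> 'rV[R]_m) :
  {for x, continuous a} -> {for x, continuous g} ->
  {for x, continuous (fun y => time_point (a y) (g y))}.
Proof.
move=> ca cg.
have -> : (fun y => time_point (a y) (g y)) =
    (fun y => a y *: time_point 1 0 + mulmxr (row_mx 0 1%:M) (g y)).
  apply/funext => y; rewrite time_pointZ /= mul_mx_row mulmx0 mulmx1 /time_point.
  by rewrite add_row_mx mulr1 scaler0 add0r addr0.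
apply: continuousD; first by apply: continuousZ => //; exact: cst_continuous.
have cL := @mulmxr_row_continuous R m (1 + m) (row_mx 0 1%:M).
exact: continuous_comp cg (cL (g x)).
Qed.

Definition edge (a b : 'rV[R]_(1 + m)) : 'M[R]_(2, 1 + m) :=
  \matrix_(i < 2) [:: a; b]`_i.

Definition triangle (a b e : 'rV[R]_(1 + m)) : 'M[R]_(3, 1 + m) :=
  \matrix_(i < 3) [:: a; b; e]`_i.

Lemma edge_mul (u : 'rV[R]_2) a b : u *m edge a b = u 0 0 *: a + u 0 1 *: b.
Proof.
apply/rowP => j; rewrite !mxE !big_ord_recl big_ord0 !mxE/= addr0.
by congr (_ + _ * _); congr (u _ _); apply/val_inj.
Qed.

Lemma triangle_mul (w : 'rV[R]_3) a b e :
  w *m triangle a b e = w 0 0 *: a + w 0 1 *: b + w 0 (inord 2) *: e.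
Proof.
apply/rowP => j; rewrite !mxE !big_ord_recl big_ord0 !mxE/= addr0 -addrA.
congr (_ + (_ * _ + _ * _)); congr (w _ _); apply/val_inj => //=.
by rewrite inordK.
Qed.

Lemma row_triangle a b e :
  [/\ row 0 (triangle a b e) = a, row 1 (triangle a b e) = b &
      row (inord 2) (triangle a b e) = e].
Proof. by split; rewrite rowK ?inordK. Qed.

Lemma face_triangle a b e :
  [/\ row' 0 (triangle a b e) = edge b e, row' 1 (triangle a b e) = edge a e &
      row' (inord 2) (triangle a b e) = edge a b].
Proof.
by split; apply/matrixP => i j; rewrite !mxE; case: i => -[|[|//]] /= ?;
  rewrite ?inordK /bump.
Qed.

Lemma barycentric2_triangle u v a b e :
  barycentric2 u v *m triangle a b e = (1 - u - v) *: a + u *: b + v *: e.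
Proof. by rewrite triangle_mul !mxE/= inordK. Qed.

End time_point.

(** The 1 x 1 matrix v *m B *m v^T is equal to its transpose, and also to the
    opposite of its transpose. *)
Lemma alternating_mx_diag (R : realType) (m : nat) (B : 'M[R]_m) (v : 'rV[R]_m) :
  B^T = - B -> v *m B *m v^T = 0.
Proof.
move=> BT; set q := v *m B *m v^T.
have qT : q^T = - q by rewrite /q !trmx_mul trmxK BT mulNmx mulmxN mulmxA.
have : q^T = q by apply/matrixP => i j; rewrite !mxE !ord1.
move=> /[dup] E; rewrite {1}qT => /eqP; rewrite eq_sym -addr_eq0 => /eqP q0.
apply/matrixP => i j; have /matrixP/(_ i j) := q0; rewrite [LHS]mxE [RHS]mxE => H.
by move/eqP: H; rewrite -mulr2n mulrn_eq0 /= [RHS]mxE => /eqP.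
Qed.

Lemma barycentric2_mul (R : realType) (k : nat) (A : 'M[R]_(3, k)) (u v : R) :
  barycentric2 u v *m A = row 0 A +
    (u *: (row 1 A - row 0 A) + v *: (row (inord 2) A - row 0 A)).
Proof.
apply/rowP => j; rewrite !mxE big_ord_recl big_ord_recl big_ord_recl big_ord0 !mxE/=.
have -> : lift ord0 (lift ord0 ord0) = inord 2 :> 'I_3.
  by apply/val_inj; rewrite /= inordK.
have -> : lift ord0 ord0 = 1 :> 'I_3 by apply/val_inj.
by rewrite -[ord0]/(0 : 'I_3); ring.
Qed.

Section density.
Context (R : realType) (m : nat) (M : manifold R m).
Implicit Types (c d : chart M) (psi : R -> M -> M) (f : R -> M -> R).

(** The flow equation constrains t + h to lie in [0, 1]; for t in ]0, 1[ this
    holds for all small h. *)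
Lemma flow_derive psi X c d P : is_flow psi X ->
  inner_time_dom c P -> dom M d (isotopy_chart psi c P) ->
  'D_(time_point 1 0) (isotopy_coord psi c d) P =
  X (lsubmx P 0 0) d (isotopy_chart psi c P).
Proof.
move=> flow bP dP; have [tP _] := bP.
set t := lsubmx P 0 0 in tP *; set y := param M c (rsubmx P).
have t01 : t \in `[0, 1] by exact: subset_itv_oo_cc.
have := flow t d y t01 dP.
set g := (fun h : R =>
  h^-1 *: (coord M d (psi (t + h) y) - coord M d (psi t y))) => Hg.
have gE : g @ 0^' --> X t d (psi t y).
  apply: cvg_trans Hg => W HW.
  have {}HW : \forall h \near 0^', t + h \in `[0, 1] -> W (g h) by exact: HW.
  have : \forall h \near 0^', t + h \in `[0, 1].
    apply: nbhs_dnbhs.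
    have : {for 0, continuous (fun h : R => t + h)}.
      by apply: continuousD; [exact: cst_continuous|exact: cvg_id].
    move=> /(_ `[0, 1]%classic); apply; rewrite addr0.
    have : nbhs t `]0, 1[%classic.
      by apply: open_nbhs_nbhs; split => //; exact: interval_open.
    by apply: filterS => z; exact: subset_itv_oo_cc.
  move=> S01; have : \forall h \near 0^', W (g h).
    by apply: filterS2 S01 HW => h Hh /(_ Hh).
  exact.
rewrite /derive; suff -> : (fun h : R => h^-1 *:
  ((isotopy_coord psi c d \o shift P) (h *: time_point 1 0) -
   isotopy_coord psi c d P)) = g by exact: cvg_lim.
apply/funext => h /=; rewrite /g /isotopy_coord /isotopy_chart.
congr (_ *: (coord M d (psi _ _) - _)).
  rewrite scale_row_mx -[X in _ + X](hsubmxK P) add_row_mx row_mxKl.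
  by rewrite mxE addrC; congr (_ + _); rewrite !mxE eqxx mulr1.
by rewrite /y scale_row_mx -[X in _ + X](hsubmxK P) add_row_mx row_mxKr scaler0
  add0r.
Qed.

(** The derivative of the simplex in u is alpha X_t plus beta times its
    derivative S in v.  As omega is alternating,
    omega(alpha X_t + beta S, S) = alpha omega(X_t, S) = - alpha d f_t(S), and
    d f_t(S) is the derivative in v of the Hamiltonian along the isotopy. *)
Lemma density_affine_simplex (omega : two_form M) f psi X c
    (A : 'M[R]_(3, 1 + m)) (alpha beta u v : R) :
  smooth_time_function f -> smooth_time_map psi -> is_flow psi X ->
  (forall t : R, t \in `[0, 1] -> hamiltonian_field omega (f t) (X t)) ->
  let v1 := row 1 A - row 0 A in let v2 := row (inord 2) A - row 0 A in
  lsubmx v2 = 0 -> v1 = alpha *: time_point 1 0 + beta *: v2 ->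
  inner_time_dom c (barycentric2 u v *m A) ->
  pullback_density omega (affine_simplex psi c A) u v =
    - alpha * 'D_v2 (energy f psi c) (barycentric2 u v *m A).
Proof.
move=> sf spsi flow ham v1 v2 v20 v1E; set P := barycentric2 u v *m A => bP.
have tP : lsubmx P 0 0 \in `[0, 1] by have [/subset_itv_oo_cc] := bP.
set x := affine_simplex psi c A (barycentric2 u v).
set d := chart_at M x.
have dx : dom M d (isotopy_chart psi c P) by exact: dom_chart_at.
set K := isotopy_coord psi c d.
have dK : differentiable K P.
  have [U [oU UP _ sK]] := isotopy_coord_smooth spsi bP dx.
  exact: C1_row_differentiable (sK 1%N).
have su : derive1 (fun u' =>
    coord M d (affine_simplex psi c A (barycentric2 u' v))) u
    = 'D_v1 K P.
  rewrite /derive1 /derive; congr (lim _); apply: (congr1 (fun g => g @ 0^')).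
  apply/funext => h; congr (_ *: (coord M d (isotopy_chart psi c _) - _)).
  rewrite /P !barycentric2_mul -/v1 -/v2 /shift/=.
  by apply/rowP => j; rewrite !mxE; ring.
have sv : derive1 (fun v' =>
    coord M d (affine_simplex psi c A (barycentric2 u v'))) v
    = 'D_v2 K P.
  rewrite /derive1 /derive; congr (lim _); apply: (congr1 (fun g => g @ 0^')).
  apply/funext => h; congr (_ *: (coord M d (isotopy_chart psi c _) - _)).
  rewrite /P !barycentric2_mul -/v1 -/v2 /shift/=.
  by apply/rowP => j; rewrite !mxE; ring.
have [_ _ ->] := energy_derive sf spsi bP dx v20.
rewrite /pullback_density -/x -/d su sv -/K.
rewrite v1E deriveE// linearP linearZ/= -!deriveE// (flow_derive flow bP dx).
rewrite !mulmxDl -!scalemxAl alternating_mx_diag ?scaler0 ?addr0; last first.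
  exact: form_alternating.
rewrite (ham _ tP d)//.
rewrite mulNmx !mxE mulrN mulNr; congr (- (_ * _)).
by apply: eq_bigr => j _; rewrite !mxE mulrC.
Qed.
End density.

(** * Integrals over segments and over affine triangles *)

Section segment_integrals.
Context (R : realType).
Implicit Types (F f G : R -> R) (a b : R).
Local Notation mu := (@lebesgue_measure R).

Lemma continuous_segment_integrable f a b : {within `[a, b], continuous f} ->
  mu.-integrable `[a, b] (EFin \o f).
Proof.
by move=> cf; apply: continuous_compact_integrable => //; exact: segment_compact.
Qed.

Lemma Rintegral_oo_cc f a b : {within `[a, b], continuous f} ->
  \int[mu]_(x in `]a, b[) f x = \int[mu]_(x in `[a, b]) f x.
Proof.
move=> /continuous_segment_integrable fi.
rewrite Rintegral_itv_obnd_cbnd; last first.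
  by apply: integrableS fi => //; exact: subset_itv_oo_cc.
rewrite Rintegral_itv_bndo_bndc//.
by apply: integrableS fi => //; exact: subset_itv_co_cc.
Qed.

Lemma Rintegral_oo_FTC F f a b : a < b ->
  (forall x, x \in `[a, b] -> is_derive x 1 F (f x)) ->
  {within `[a, b], continuous f} ->
  \int[mu]_(x in `]a, b[) f x = F b - F a.
Proof.
move=> ab dF cf; rewrite Rintegral_oo_cc// /Rintegral.
rewrite (@continuous_FTC2 _ _ F)//.
- have cF x : x \in `[a, b] -> {for x, continuous F}.
    move=> /dF [dFx _]; exact/differentiable_continuous/derivable1_diffP.
  split.
  + by move=> x /subset_itv_oo_cc /dF[].
  + by apply: cvg_at_right_filter; apply: cF; rewrite in_itv/= lexx ltW.
  + by apply: cvg_at_left_filter; apply: cF; rewrite in_itv/= lexx ltW.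
- by move=> x /subset_itv_oo_cc /dF[_ <-]; rewrite derive1E.
Qed.

Lemma Rintegral_oo_flip G : {within `[0, 1], continuous G} ->
  \int[mu]_(x in `]0, 1[) G (1 - x) = \int[mu]_(x in `[0, 1]) G x.
Proof.
move=> cG.
have c1 : {within `[0, 1], continuous (fun x : R => 1 - x)}.
  apply: continuous_subspaceT => x.
  by apply: continuousB; [exact: cst_continuous|exact: cvg_id].
have cG1 : {within `[0, 1], continuous (fun x : R => G (1 - x))}.
  have m1 (x : R) : `[0, 1]%classic x -> `[0, 1]%classic (1 - x).
    by rewrite /= !in_itv/= => /andP[? ?]; apply/andP; split; lra.
  exact: continuous_within_comp m1 c1 cG.
rewrite (@Rintegration_by_substitution_onem _ G 1) ?lexx ?ler01//.
by rewrite unstable.onem1 (Rintegral_oo_cc cG1).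
Qed.

End segment_integrals.

Section prism.
Context (R : realType) (m : nat) (M : manifold R m).
Implicit Types (c d : chart M) (psi : R -> M -> M) (f : R -> M -> R).
Local Notation mu := (@lebesgue_measure R).

(** Time is constant along v2, so the inner integral of the density is the
    increment of - alpha times the Hamiltonian along the isotopy, from v = 0
    to v = 1 - u. *)
Lemma integral_affine_simplex (omega : two_form M) f psi X c
    (A : 'M[R]_(3, 1 + m)) (alpha beta : R) :
  smooth_time_function f -> smooth_time_map psi -> is_flow psi X ->
  (forall t : R, t \in `[0, 1] -> hamiltonian_field omega (f t) (X t)) ->
  let v1 := row 1 A - row 0 A in let v2 := row (inord 2) A - row 0 A in
  lsubmx v2 = 0 -> v1 = alpha *: time_point 1 0 + beta *: v2 ->
  (forall u v, u \in `]0, 1[ -> v \in `[0, 1 - u] ->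
    inner_time_dom c (barycentric2 u v *m A)) ->
  integral_simplex omega (affine_simplex psi c A) =
  \int[mu]_(u in `]0, 1[)
    (- alpha * energy f psi c (barycentric2 u (1 - u) *m A) +
     alpha * energy f psi c (barycentric2 u 0 *m A)).
Proof.
move=> sf spsi flow ham v1 v2 v20 v1E box.
rewrite /integral_simplex; apply: eq_Rintegral => u /[!inE]/= u01.
pose line v := barycentric2 u 0 *m A + v *: v2.
have lineE v : barycentric2 u v *m A = line v.
  by rewrite /line !barycentric2_mul -/v2 scale0r addr0 addrA.
have box' v : v \in `[0, 1 - u] -> inner_time_dom c (line v).
  by move=> v01; rewrite -lineE; exact: box.
pose g v := - alpha * 'D_v2 (energy f psi c) (line v).
pose G v := - alpha * energy f psi c (line v).
transitivity (\int[mu]_(v in `]0, 1 - u[) g v).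
  apply: eq_Rintegral => v /[!inE]/= v01.
  rewrite (density_affine_simplex sf spsi flow ham v20 v1E) ?lineE//.
  by apply: box'; exact: subset_itv_oo_cc.
have u1 : 0 < 1 - u by move: u01; rewrite in_itv/= => /andP[_]; rewrite subr_gt0.
have energyE v : v \in `[0, 1 - u] -> derivable (energy f psi c) (line v) v2 /\
    {for line v, continuous ('D_v2 (energy f psi c))}.
  move=> v01; have bv := box' v v01.
  have dv := dom_chart_at (isotopy_chart psi c (line v)).
  by have [] := energy_derive sf spsi bv dv v20.
have dG v : v \in `[0, 1 - u] -> is_derive v 1 G (g v).
  move=> /energyE[dE _]; have d1 := is_derive_line dE.
  exact: is_deriveZ.
have cg : {within `[0, 1 - u], continuous g}.
  apply: continuous_within_for => v /energyE[_ cE].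
  apply: continuousM; first exact: cst_continuous.
  apply: (@continuous_comp _ _ _ line ('D_v2 (energy f psi c))) => //.
  apply: continuousD; first exact: cst_continuous.
  exact: continuousZ (@cvg_id _ _) (@cst_continuous _ _ v2 v).
by rewrite (Rintegral_oo_FTC u1 dG cg) /G -!lineE mulNr mulNr opprK.
Qed.

End prism.

(** * Continuity in time and faces of affine triangles *)

Lemma smooth_on_continuous (R : realType) (a : nat) (W : normedModType R)
    (A : set 'rV[R]_a) (g : 'rV[R]_a -> W) :
  smooth_on A g -> {within A, continuous g}.
Proof.
move=> sg; apply/subspace_continuousP => x Ax.
have [U [h [oU Ux sh hg]]] := sg x Ax.
have [ch _] := sh 0%N.
have gx : h x = g x by exact: hg.
move=> B gB; have /(ch x Ux) hB : nbhs (h x) B by rewrite gx.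
have nU : nbhs x U by exact: open_nbhs_nbhs.
have : \forall y \near x, A y -> B (g y).
  by apply: filterS2 nU hB => y Uy By Ay; rewrite -hg.
exact.
Qed.

Section prism.
Context (R : realType) (m : nat) (M : manifold R m).
Implicit Types (c d : chart M) (psi : R -> M -> M) (f : R -> M -> R).
Local Notation mu := (@lebesgue_measure R).

(** Smoothness in charts gives joint continuity in time and space near (t, x),
    the chart at x being defined on an open set. *)
Lemma time_function_continuous f : smooth_time_function f ->
  {within [set p : R * M | p.1 \in `[0, 1]],
    continuous (fun p : R * M => f p.1 p.2)}.
Proof.
move=> sf; apply/subspace_continuousP => -[t x] t01.
set d := chart_at M x.
pose O : set (R * M) := [set p | dom M d p.2].
have nO : nbhs (t, x) O.
  apply: (@cvg_snd _ _ (nbhs t) (nbhs x) _ (dom M d)).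
  by apply: open_nbhs_nbhs; split; [exact: open_dom|exact: dom_chart_at].
pose A : set (R * M) := [set p | (p.1 \in `[0, 1]) /\ dom M d p.2].
pose k (p : R * M) := time_point p.1 (coord M d p.2).
have kA p : A p -> time_dom d (k p).
  move=> [p1 p2]; split; rewrite ?time_point_time ?time_point_pos//.
  exact: coord_domP.
have ck : {within A, continuous k}.
  apply: continuous_within_for => -[s y] [_ dy]; apply: continuous_time_point.
    exact: cvg_fst.
  apply: (@continuous_comp _ _ _ snd (coord M d)); first exact: cvg_snd.
  exact: coord_continuous_at.
have cF := continuous_within_comp kA ck (smooth_on_continuous (sf d)).
move=> B HB.
have Atx : A (t, x) by split => //; exact: dom_chart_at.
have kE p : A p -> function_chart f d (k p) = f p.1 p.2.
  by move=> [_ dp]; rewrite /function_chart time_point_time time_point_pos coordK.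
have HA : \forall p \near (t, x), A p -> B (f p.1 p.2).
  have kB : nbhs ((function_chart f d \o k) (t, x)) B by rewrite /= kE.
  move/subspace_continuousP : cF => /(_ (t, x) Atx B kB) HB'.
  have : \forall p \near (t, x), A p -> B (function_chart f d (k p)).
    exact: HB'.
  by apply: filterS => p Hp Ap; rewrite -kE//; exact: Hp.
have : \forall p \near (t, x), p.1 \in `[0, 1] -> B (f p.1 p.2).
  by apply: filterS2 nO HA => p Op Hp p01; apply: Hp.
exact.
Qed.

Lemma energy_continuous f psi c :
  smooth_time_function f -> smooth_time_map psi ->
  {within time_dom c, continuous (energy f psi c)}.
Proof.
move=> sf spsi.
have H w : time_dom c w ->
    [set p : R * M | p.1 \in `[0, 1]] (lsubmx w 0 0, isotopy_chart psi c w).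
  by move=> [].
suff cw : {within time_dom c, continuous (fun w : 'rV[R]_(1 + m) =>
    (lsubmx w 0 0 : R, isotopy_chart psi c w))}.
  exact: (continuous_within_comp H cw (time_function_continuous sf)).
have /subspace_continuousP cp := isotopy_chart_continuous (c := c) spsi.
apply/subspace_continuousP => w tw.
have ct : (fun w : 'rV[R]_(1 + m) => lsubmx w 0 0 : R) @
    within (time_dom c) (nbhs w) --> (lsubmx w 0 0 : R).
  by apply: cvg_within_filter; exact: time_continuous.
exact: (cvg_pair ct (cp w tw)).
Qed.

Lemma affine_simplex_face psi c k (A : 'M[R]_(k.+2, 1 + m)) i :
  simplex_face i (affine_simplex psi c A) = affine_simplex psi c (row' i A).
Proof.
apply/funext => u; rewrite /simplex_face /affine_simplex; congr isotopy_chart.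
apply/rowP => j; rewrite !mxE (bigD1_ord i)//= !mxE unlift_none mul0r add0r.
by apply: eq_bigr => l _; rewrite !mxE liftK.
Qed.

Lemma coboundary_triangle psi c (b : simplex M 1 -> R) x y e :
  coboundary b (affine_simplex psi c (triangle x y e)) =
  b (affine_simplex psi c (edge y e)) - b (affine_simplex psi c (edge x e)) +
  b (affine_simplex psi c (edge x y)).
Proof.
have [E0 E1 E2] := face_triangle x y e.
rewrite /coboundary !big_ord_recl big_ord0 !affine_simplex_face.
rewrite -[ord0]/(0 : 'I_3) E0.
have -> : lift ord0 (lift ord0 ord0) = inord 2 :> 'I_3.
  by apply/val_inj; rewrite /= inordK.
have -> : lift ord0 ord0 = 1 :> 'I_3 by apply/val_inj.
rewrite E1 E2 /= inordK//.
by rewrite expr0 expr1 sqrrN expr1n mulrN1z !mulr1z addr0 addrA.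
Qed.

End prism.

(** * The rectangle swept by a segment *)

Section prism_difference.
Context (R : realType) (m : nat) (M : manifold R m).
Context (c : chart M) (psi : R -> M -> M) (f : R -> M -> R) (p q : 'rV[R]_m).
Local Notation mu := (@lebesgue_measure R).

Definition segment_in_chart := forall r : R, r \in `[0, 1] ->
  coord_dom c ((1 - r) *: p + r *: q).

(** The rectangle [0, 1] x [p, q] is cut along the diagonal from (1, p) to
    (0, q).  In both triangles the first and the last vertex are at the same
    time, which makes time depend only on the outer variable of integration;
    the two sides [p, q] and the diagonal are oriented alike in both. *)
Definition lower_triangle : simplex M 2 := affine_simplex psi c
  (triangle (time_point 0 p) (time_point 1 p) (time_point 0 q)).

Definition upper_triangle : simplex M 2 := affine_simplex psi c
  (triangle (time_point 1 p) (time_point 0 q) (time_point 1 q)).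

Lemma std_simplex2P (w : 'rV[R]_3) : std_simplex R 2 w ->
  [/\ 0 <= w 0 0, 0 <= w 0 1, 0 <= w 0 (inord 2) &
      w 0 0 + w 0 1 + w 0 (inord 2) = 1].
Proof.
move=> [w0 w1]; split => //.
rewrite -w1 !big_ord_recl big_ord0 addr0 addrA.
by congr (_ + w _ _ + w _ _); apply/val_inj; rewrite //= inordK.
Qed.

Lemma std_simplex1P (w : 'rV[R]_2) : std_simplex R 1 w ->
  [/\ 0 <= w 0 0, 0 <= w 0 1 & w 0 0 + w 0 1 = 1].
Proof.
move=> [w0 w1]; split => //.
rewrite -w1 !big_ord_recl big_ord0 addr0.
by congr (_ + w _ _); apply/val_inj.
Qed.

Lemma smooth_lower_triangle : smooth_time_map psi -> segment_in_chart ->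
  smooth_simplex lower_triangle.
Proof.
move=> spsi seg; apply: smooth_affine_simplex => // w /std_simplex2P[w0 w1 w2 w3].
rewrite triangle_mul !time_pointZ !time_pointD.
split; rewrite ?time_point_time ?time_point_pos.
  by rewrite !mulr0 mulr1 add0r addr0 in_itv/=; apply/andP; split; lra.
rewrite -scalerDl (_ : w 0 0 + w 0 1 = 1 - w 0 (inord 2)); last by rewrite -w3; ring.
by apply: seg; rewrite in_itv/=; apply/andP; split; lra.
Qed.

Lemma smooth_upper_triangle : smooth_time_map psi -> segment_in_chart ->
  smooth_simplex upper_triangle.
Proof.
move=> spsi seg; apply: smooth_affine_simplex => // w /std_simplex2P[w0 w1 w2 w3].
rewrite triangle_mul !time_pointZ !time_pointD.
split; rewrite ?time_point_time ?time_point_pos.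
  by rewrite !mulr0 !mulr1 addr0 in_itv/=; apply/andP; split; lra.
rewrite -addrA -scalerDl (_ : w 0 0 = 1 - (w 0 1 + w 0 (inord 2))); last first.
  by rewrite -w3; ring.
by apply: seg; rewrite in_itv/=; apply/andP; split; lra.
Qed.

(** The diagonal occurs in both coboundaries with the same sign, and the edges
    at times 0 and 1 are the same simplex because psi_0 = psi_1 = id; the two
    remaining edges are the orbits. *)
Lemma coboundary_prism (b : simplex M 1 -> R) : is_cochain b ->
  (forall x, psi 0 x = x) -> (forall x, psi 1 x = x) ->
  coboundary b lower_triangle - coboundary b upper_triangle =
  b (orbit_simplex psi (param M c p)) - b (orbit_simplex psi (param M c q)).
Proof.
move=> hb psi0 psi1; rewrite !coboundary_triangle.
have orbit z : b (affine_simplex psi c (edge (time_point 0 z) (time_point 1 z))) =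
    b (orbit_simplex psi (param M c z)).
  apply: hb => u /std_simplex1P[_ _ u1].
  rewrite /affine_simplex /isotopy_chart /orbit_simplex edge_mul !time_pointZ
    time_pointD.
  rewrite time_point_time time_point_pos mulr0 mulr1 add0r -scalerDl u1 scale1r.
  by congr (psi (u _ _) _); apply/val_inj.
rewrite !orbit.
have -> : b (affine_simplex psi c (edge (time_point 1 p) (time_point 1 q))) =
          b (affine_simplex psi c (edge (time_point 0 p) (time_point 0 q))).
  apply: hb => u /std_simplex1P[_ _ u1].
  rewrite /affine_simplex /isotopy_chart !edge_mul !time_pointZ !time_pointD.
  by rewrite !time_point_time !time_point_pos !mulr0 !mulr1 addr0 u1 psi0 psi1.
ring.
Qed.

(** With g2, g3 the Hamiltonian along the orbits and g1 its value along the
    diagonal, the lower triangle contributes the integral of g2 - g1, and the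
    upper one, in which time runs backwards, that of g3 - g1. *)
Lemma integral_prism (omega : two_form M) X :
  smooth_time_function f -> smooth_time_map psi -> is_flow psi X ->
  (forall t : R, t \in `[0, 1] -> hamiltonian_field omega (f t) (X t)) ->
  segment_in_chart ->
  integral_simplex omega lower_triangle - integral_simplex omega upper_triangle =
  \int[mu]_(t in `[0, 1]) f t (psi t (param M c p)) -
  \int[mu]_(t in `[0, 1]) f t (psi t (param M c q)).
Proof.
move=> sf spsi flow ham seg.
pose E t z := energy f psi c (time_point t z).
pose g1 t := E t (t *: p + (1 - t) *: q).
pose g2 t := E t p.
pose g3 t := E t q.
have cE (h : R -> 'rV[R]_m) : continuous h ->
    (forall t, t \in `[0, 1] -> coord_dom c (h t)) ->
    {within `[0, 1], continuous (fun t => E t (h t))}.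
  move=> ch hc.
  have hA t : `[0, 1]%classic t -> time_dom c (time_point t (h t)).
    by move=> t01; split; rewrite ?time_point_time ?time_point_pos//; exact: hc.
  apply: (continuous_within_comp hA); last exact: energy_continuous.
  apply: continuous_subspaceT => t.
  by apply: continuous_time_point; [exact: cvg_id|exact: ch].
have cp : coord_dom c p.
  have := seg 0; rewrite subr0 scale1r scale0r addr0; apply.
  by rewrite in_itv/= lexx ler01.
have cq : coord_dom c q.
  have := seg 1; rewrite subrr scale1r scale0r add0r; apply.
  by rewrite in_itv/= lexx ler01.
have cg1 : {within `[0, 1], continuous g1}.
  have ch : continuous (fun t : R => t *: p + (1 - t) *: q).
    move=> t.
    have c1 : {for t, continuous (fun t : R => t *: p)}.
      by apply: continuousZ; [exact: cvg_id|exact: cst_continuous].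
    have c2 : {for t, continuous (fun t : R => (1 - t) *: q)}.
      apply: continuousZ; last exact: cst_continuous.
      by apply: continuousB; [exact: cst_continuous|exact: cvg_id].
    exact: continuousD c1 c2.
  apply: (cE _ ch) => t t01.
  have := seg (1 - t); rewrite subKr; apply.
  by move: t01; rewrite !in_itv/= => /andP[? ?]; apply/andP; split; lra.
have cg2 : {within `[0, 1], continuous g2}.
  by apply: (cE (fun _ => p)) => // t; exact: cst_continuous.
have cg3 : {within `[0, 1], continuous g3}.
  by apply: (cE (fun _ => q)) => // t; exact: cst_continuous.
have c21 : {within `[0, 1], continuous (fun t => g2 t - g1 t)}.
  by move=> t; exact: continuousB (cg2 t) (cg1 t).
have c31 : {within `[0, 1], continuous (fun t => g3 t - g1 t)}.
  by move=> t; exact: continuousB (cg3 t) (cg1 t).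
have orbitE z : \int[mu]_(t in `[0, 1]) f t (psi t (param M c z)) =
                \int[mu]_(t in `[0, 1]) E t z.
  apply: eq_Rintegral => t _.
  by rewrite /E /energy /isotopy_chart time_point_time time_point_pos.
rewrite !orbitE -/g2 -/g3.
have -> : integral_simplex omega lower_triangle =
    \int[mu]_(t in `[0, 1]) g2 t - \int[mu]_(t in `[0, 1]) g1 t.
  have [r0 r1 r2] :=
    row_triangle (time_point 0 p) (time_point 1 p) (time_point 0 q).
  (* (t, r) = (u, v): the first edge is d/dt. *)
  rewrite (integral_affine_simplex sf spsi flow ham (alpha := 1) (beta := 0));
    last 3 first.
  - by rewrite r0 r2 time_pointB row_mxKl subrr raddf0.
  - by rewrite r0 r1 time_pointB subr0 subrr scale1r scale0r addr0.
  - move=> u v; rewrite !in_itv/= => /andP[u0 u1] /andP[v0 v1].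
    rewrite barycentric2_triangle !time_pointZ !time_pointD.
    split; rewrite ?time_point_time ?time_point_pos.
      by rewrite !mulr0 mulr1 add0r addr0 in_itv/= u0 u1.
    rewrite -scalerDl (_ : 1 - u - v + u = 1 - v); last by ring.
    by apply: seg; rewrite in_itv/=; apply/andP; split; lra.
  rewrite -RintegralB//; [|exact: continuous_segment_integrable..].
  rewrite -(Rintegral_oo_cc c21).
  apply: eq_Rintegral => u _.
  rewrite !barycentric2_triangle !time_pointZ !time_pointD.
  rewrite /g1 /g2 /E mulN1r mul1r addrC !mulr0 !mulr1 !subr0 !add0r !addr0.
  rewrite scale0r addr0 -scalerDl subrK scale1r.
  by rewrite (_ : 1 - u - (1 - u) = 0) ?subrr// scale0r add0r.
have -> : integral_simplex omega upper_triangle =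
    \int[mu]_(t in `[0, 1]) g3 t - \int[mu]_(t in `[0, 1]) g1 t.
  have [r0 r1 r2] :=
    row_triangle (time_point 1 p) (time_point 0 q) (time_point 1 q).
  (* (t, r) = (1 - u, u + v): the first edge is - d/dt + d/dr. *)
  rewrite (integral_affine_simplex sf spsi flow ham (alpha := -1) (beta := 1));
    last 3 first.
  - by rewrite r0 r2 time_pointB row_mxKl subrr raddf0.
  - rewrite r0 r1 r2 time_pointZ !time_pointB scale1r time_pointD.
    by rewrite scaler0 !add0r mulr1 subrr addr0.
  - move=> u v; rewrite !in_itv/= => /andP[u0 u1] /andP[v0 v1].
    rewrite barycentric2_triangle !time_pointZ !time_pointD.
    split; rewrite ?time_point_time ?time_point_pos.
      by rewrite !mulr0 !mulr1 addr0 in_itv/=; apply/andP; split; lra.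
    rewrite -addrA -scalerDl (_ : 1 - u - v = 1 - (u + v)); last by ring.
    by apply: seg; rewrite in_itv/=; apply/andP; split; lra.
  rewrite -RintegralB//; [|exact: continuous_segment_integrable..].
  rewrite -(Rintegral_oo_flip c31).
  apply: eq_Rintegral => u _.
  rewrite !barycentric2_triangle !time_pointZ !time_pointD.
  rewrite /g1 /g3 /E opprK mul1r mulN1r !mulr0 !mulr1 !subr0 !addr0 subrr.
  by rewrite !scale0r add0r addr0 add0r -scalerDl subrKC scale1r subKr.
ring.
Qed.

End prism_difference.

(** * The action modulo integers *)

Lemma segment_in_ball (R : realType) (m : nat) (M : manifold R m) (c : chart M)
    (p q : 'rV[R]_m) (e : R) :
  ball p e `<=` coord_dom c -> ball p e q -> segment_in_chart c p q.
Proof.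
move=> sub pq r; rewrite in_itv/= => /andP[r0 r1]; apply: sub.
move: pq; rewrite -!ball_normE/= => pq.
have -> : p - ((1 - r) *: p + r *: q) = r *: (p - q).
  by apply/rowP => j; rewrite !mxE; ring.
rewrite normrZ ger0_norm//; apply: le_lt_trans pq.
by rewrite -[leRHS]mul1r ler_wpM2r.
Qed.

(** The set of points congruent to a given one is open, and so is its
    complement. *)
Lemma connected_locally_congruent (R : realType) (T : topologicalType) (h : T -> R) :
  connected [set: T] ->
  (forall x, \forall y \near x, exists k : int, h y - h x = k%:~R) ->
  forall x y, exists k : int, h y - h x = k%:~R.
Proof.
move=> cT hloc a b.
pose A := [set y | exists k : int, h y - h a = k%:~R].
have trans y z : (exists k : int, h z - h y = k%:~R) -> A y -> A z.
  move=> [k hk] [l hl]; exists (k + l).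
  by rewrite intrD -hk -hl; ring.
have sym y z : (exists k : int, h z - h y = k%:~R) ->
    exists k : int, h y - h z = k%:~R.
  by move=> [k hk]; exists (- k); rewrite intrN -hk opprB.
have oA : open A.
  rewrite openE => y Ay; rewrite /interior; apply: filterS (hloc y) => z zy.
  exact: trans zy Ay.
have cA : closed A.
  rewrite -openC openE => y nAy; rewrite /interior.
  by apply: filterS (hloc y) => z /sym zy Az; apply: nAy; exact: trans zy Az.
have AT : A = [set: T].
  apply: cT.
  - by exists a, 0; rewrite subrr.
  - by exists A => //; rewrite setTI.
  - by exists A => //; rewrite setTI.
by have : A b by rewrite AT.
Qed.

Lemma cexp_imaginary (R : realType) (u : R) :
  cexp (Complex 0 u) = Complex (cos u) (sin u).
Proof. by rewrite /cexp/= expR0 mul1r. Qed.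

Lemma kappaE (R : realType) (n : nat) (M : manifold R n.*2)
    (omega : two_form M) (f : R -> M -> R) (psi : R -> M -> M) (x : M)
    (S : chain M 2) :
  let u := 2 * pi * (integral_chain omega S -
     \int[lebesgue_measure]_(t in `[0, 1]) f t (psi t x)) in
  kappa omega f psi x S = Complex (cos u) (sin u).
Proof.
move=> u; rewrite /kappa -cexp_imaginary; congr cexp.
apply/eqP; rewrite eq_complex /= !mul0r !mulr0 /u.
by apply/andP; split; apply/eqP; ring.
Qed.

Lemma unit_circle_periodic (R : realType) (u : R) (k : int) :
  Complex (cos (2 * pi * (u + k%:~R))) (sin (2 * pi * (u + k%:~R))) =
  Complex (cos (2 * pi * u)) (sin (2 * pi * u)).
Proof.
have H (v : R) (l : nat) :
    Complex (cos (2 * pi * (v + l%:R))) (sin (2 * pi * (v + l%:R))) =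
    Complex (cos (2 * pi * v)) (sin (2 * pi * v)).
  elim: l v => [|l IH] v; first by rewrite addr0.
  rewrite -(IH v) (_ : 2 * pi * (v + l.+1%:R) = 2 * pi * (v + l%:R) + pi *+ 2).
    by rewrite cosD2pi sinD2pi.
  by rewrite -[l.+1%:R]natr1; ring.
case: k => l; first exact: H.
by rewrite NegzE -[in RHS](subrK l.+1%:R u) H intrN.
Qed.

Lemma unit_circle_norm (R : realType) (u : R) :
  `|Complex (cos u) (sin u)| = 1 :> R[i].
Proof. by rewrite normc_def/= cos2Dsin2 sqrtr1. Qed.

Theorem theorem4 (R : realType) (n : nat) (M : manifold R n.*2)
    (omega : two_form M) (f : R -> M -> R) (psi : R -> M -> M) :
  compact [set: M] -> connected [set: M] ->
  symplectic omega -> integral_class omega ->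
  closed_hamiltonian_isotopy omega f psi ->
  exists c : R[i], `|c| = 1 /\
    forall (x : M) (S : chain M 2), spans_orbit psi x S ->
      kappa omega f psi x S = c.
Proof.
move=> _ conM _ [z [b [_ hb _ omegaE]]] [[sf _ spsi psi0 [X [ham flow]]] psi1].
pose F x := \int[lebesgue_measure]_(t in `[0, 1]) f t (psi t x).
pose h x := b (orbit_simplex psi x) - F x.
have hloc x : \forall y \near x, exists k : int, h y - h x = k%:~R.
  pose c := chart_at M x; have cx : dom M c x by exact: dom_chart_at.
  have /open_nbhs_nbhs/nbhs_ballP[e /= e0 he] :
      open_nbhs (coord M c x) (coord_dom c).
    by split; [exact: open_coord|exact: coord_domP].
  have near_dom : nbhs x (dom M c).
    by apply: open_nbhs_nbhs; split; [exact: open_dom|exact: cx].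
  have near_ball : \forall y \near x, ball (coord M c x) e (coord M c y).
    have cc := coord_continuous_at cx.
    by apply: (cc (ball (coord M c x) e)); exact: nbhsx_ballx.
  apply: filterS2 near_dom near_ball => y cy hy.
  have seg := segment_in_ball he hy.
  have := integral_prism sf spsi flow ham seg.
  rewrite (omegaE _ (smooth_lower_triangle spsi seg)).
  rewrite (omegaE _ (smooth_upper_triangle spsi seg)).
  have := coboundary_prism c (coord M c x) (coord M c y) hb psi0 psi1.
  rewrite !coordK// -/(F x) -/(F y) => Eb EF.
  set k1 := z _ in EF; set k2 := z _ in EF.
  exists (k1 - k2); rewrite intrB /h; move: Eb EF; lra.
have hcong := connected_locally_congruent conM hloc.
have kappa_h x S : spans_orbit psi x S ->
    kappa omega f psi x S = Complex (cos (2 * pi * h x)) (sin (2 * pi * h x)).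
  move=> /(integral_spanning_chain hb omegaE) intS.
  rewrite kappaE intS -addrA [_%:~R + _]addrC.
  exact: unit_circle_periodic.
have [[x0 _]|empty] := pselect (exists x : M, True); last first.
  exists 1; split; first exact: normr1.
  by move=> x; exfalso; apply: empty; exists x.
exists (Complex (cos (2 * pi * h x0)) (sin (2 * pi * h x0))); split.
  exact: unit_circle_norm.
move=> x S /kappa_h ->; have [k hk] := hcong x0 x.
by rewrite -(unit_circle_periodic (h x0) k) -hk addrCA subrr addr0.
Qed.
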